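(* Let $X_\Delta$ be an $n$-dimensional smooth complete toric variety over $\mathbb{C}$ with fan $\Delta$. For every integer $k$ with $1\le k\le n$, $$H^0\Big(X_\Delta,\bigwedge\nolimits^k T_{X_\Delta}\Big)=\bigoplus_{\substack{u\in P_\Delta\cap M\\ i(u)\le k}}\chi^u\rho_N(N_u^k).$$ If $u\in P_\Delta$ lies in the relative interior of a face of $P_\Delta$ of codimension $i$, then $i(u)=i$ and, for such $u\in M$, $$\dim_{\mathbb{C}}\chi^u\rho_N(N_u^k)=\binom{n-i}{k-i}.$$ Consequently, $$\dim_{\mathbb{C}}H^0\Big(X_\Delta,\bigwedge\nolimits^k T_{X_\Delta}\Big)=\sum_{i=0}^{k}\binom{n-i}{k-i}\sum_{\substack{F\preceq P_\Delta\\ \operatorname{codim}F=i}}\#\big(\operatorname{relint}(F)\cap M\big).$$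
   Context: Let $N\cong\mathbb{Z}^n$ be a lattice, $M=\operatorname{Hom}(N,\mathbb{Z})$ its dual, $\langle-,-\rangle$ the natural pairing (extended linearly), $N_{\mathbb{R}}=N\otimes\mathbb{R}$, $N_{\mathbb{C}}=N\otimes\mathbb{C}$, $M_{\mathbb{R}}=M\otimes\mathbb{R}$. $\Delta$ is a smooth complete fan in $N_{\mathbb{R}}$, $\Delta(1)$ is its set of rays, and $v_\rho\in N$ is the primitive generator of $\rho\in\Delta(1)$. $X_\Delta$ is the associated toric variety with dense torus $T=N\otimes_{\mathbb{Z}}\mathbb{C}^*$. Global sections are algebraic, equivalently holomorphic by GAGA. The polytope is $P_\Delta=\{u\in M_{\mathbb{R}}\mid\langle u,v_\rho\rangle\ge-1\text{ for every }\rho\in\Delta(1)\}$, a full-dimensional compact polytope. $F\preceq P_\Delta$ means $F$ is a (nonempty) face, $P_\Delta$ itself being the face of codimension $0$; $\operatorname{relint}(F)$ is its relative interior. For $u\in P_\Delta$ put $A(u)=\{\rho\in\Delta(1)\mid\langle u,v_\rho\rangle=-1\}$, $L_u=\operatorname{Span}_{\mathbb{C}}\{v_\rho\mid\rho\in A(u)\}\subseteq N_{\mathbb{C}}$, $i(u)=\dim_{\mathbb{C}}L_u$. For $1\le k\le n$ define the subspace $N_u^k\subseteq\bigwedge^kN_{\mathbb{C}}$ by $N_u^k=\bigwedge^{i(u)}L_u\wedge\bigwedge^{k-i(u)}N_{\mathbb{C}}$ if $i(u)\le k$, and $N_u^k=0$ if $i(u)>k$ (here $V\wedge W$ denotes the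 linear span of all products $v\wedge w$). For $u\in M$, $\chi^u:T\to\mathbb{C}^*$ is the corresponding character, viewed also as a rational function on $X_\Delta$. The infinitesimal torus action gives the map $\rho_N:N_{\mathbb{C}}\to H^0(X_\Delta,T_{X_\Delta})$ with $\rho_N(x)(\chi^u)=\langle u,x\rangle\chi^u$, and $\rho_N:\bigwedge^kN_{\mathbb{C}}\to H^0(X_\Delta,\bigwedge^kT_{X_\Delta})$ also denotes its (injective) exterior extension. $\chi^u\rho_N(N_u^k)=\{\chi^u\rho_N(\xi)\mid\xi\in N_u^k\}$ is a space of rational $k$-vector fields on $X_\Delta$ (regular on $T$); global sections are identified with rational $k$-vector fields by restriction to $T$. Convention: $\binom{a}{b}=0$ if $b<0$. *)

(* Defs.v *)
From HB Require Import structures.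
From mathcomp Require Import all_boot all_order all_algebra.
From mathcomp Require Import finmap complex monalg.
From mathcomp Require Import boolp classical_sets functions cardinality.
From mathcomp Require Import fsbigop reals topology normedtype.

Set Implicit Arguments.
Unset Strict Implicit.
Unset Printing Implicit Defensive.

Import Order.TTheory GRing.Theory Num.Theory.
Import numFieldNormedType.Exports.

Local Open Scope classical_set_scope.
Local Open Scope ring_scope.

Section LinearAlgebra.
Context {K : fieldType} {V : lmodType K}.
Implicit Types (S W : set V).

Definition lspan S : set V :=
  [set x | exists (m : nat) (c : 'I_m -> K) (s : 'I_m -> V),
    (forall i, S (s i)) /\ x = \sum_(i < m) c i *: s i].

Definition lin_indep (d : nat) (b : 'I_d -> V) : Prop :=
  forall c : 'I_d -> K, \sum_(i < d) c i *: b i = 0 -> forall i, c i = 0.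

(* V may be infinite-dimensional, so \dim of vector.v does not apply. *)
Definition has_dim W (d : nat) : Prop :=
  exists b : 'I_d -> V, lin_indep b /\ W = lspan (range b).

Definition direction S : set V :=
  lspan [set z | exists x y, [/\ S x, S y & z = x - y]].

Definition aff_hull S : set V :=
  [set z | exists x w, [/\ S x, direction S w & z = x + w]].

Definition has_affdim S (d : nat) : Prop := has_dim (direction S) d.

(* W is the internal direct sum of the subspaces F i, for i in I. *)
Definition is_direct_sum {T : eqType} (I : set T) (F : T -> set V) W : Prop :=
  W = [set x | exists (s : seq T) (w : T -> V),
        [/\ uniq s, forall i, i \in s -> I i /\ F i (w i)
          & x = \sum_(i <- s) w i]]
  /\ forall (s : seq T) (w : T -> V), uniq s ->
       (forall i, i \in s -> I i /\ F i (w i)) ->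
       \sum_(i <- s) w i = 0 -> forall i, i \in s -> w i = 0.

End LinearAlgebra.

Section ExteriorAlgebra.
Variables (K : fieldType) (n : nat).

(* The exterior algebra of K^n; the function that is 1 at S = {s_1 < ... < s_k}
   and 0 elsewhere stands for e_{s_1} /\ ... /\ e_{s_k}. *)
Definition ext : lmodType K := {ffun {set 'I_n} -> K^o}.

(* e_A /\ e_B = (-1)^(ninv A B) e_(A :|: B) for disjoint A and B. *)
Definition ninv (A B : {set 'I_n}) : nat :=
  #|[set p : 'I_n * 'I_n | [&& p.1 \in A, p.2 \in B & (p.2 < p.1)%N]]|.

Definition extmul (a b : ext) : ext :=
  [ffun S : {set 'I_n} =>
    \sum_(A : {set 'I_n} | A \subset S)
       (-1) ^+ ninv A (S :\: A) * (a A * b (S :\: A)) : K^o].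

Definition ext1 : ext := [ffun S : {set 'I_n} => (S == finset.set0)%:R : K^o].

Definition extvec (x : 'rV[K]_n) : ext :=
  [ffun S : {set 'I_n} => \sum_(i | S == [set i]%SET) x 0 i : K^o].

(* The exterior power of a subspace, inside the exterior algebra. *)
Definition extpow (k : nat) (V : set 'rV[K]_n) : set ext :=
  lspan [set a | exists x : 'I_k -> 'rV[K]_n, (forall i, V (x i)) /\
                  a = \big[extmul/ext1]_(i < k) extvec (x i)].

Definition extwedge (V W : set ext) : set ext :=
  lspan [set a | exists v w, [/\ V v, W w & a = extmul v w]].

End ExteriorAlgebra.

Section GroupAlgebra.
Variables (K : fieldType) (G : zmodType).

(* The ring structure of monalg.v on {malg K[G]} requires a monoid without
   nontrivial units, so the group algebra is built here in the same way. *)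
Definition galg : Type := {malg K[G]}.
HB.instance Definition _ := GRing.Lmodule.on galg.

Definition gchar (u : G) : galg := << 1 *g u >>.

Definition galg_mul (f g : galg) : galg :=
  \sum_(u <- msupp f) \sum_(v <- msupp g) << f@_u * g@_v *g (u + v)%R >>.

Local Open Scope fset_scope.

Lemma galg_mulw (d1 d2 : {fset G}) (f g : galg) :
  msupp f `<=` d1 -> msupp g `<=` d2 ->
  galg_mul f g =
    \sum_(u <- d1) \sum_(v <- d2) << f@_u * g@_v *g (u + v)%R >>.
Proof.
move=> le1 le2; rewrite /galg_mul (big_fset_incl _ le1) /=.
  apply/eq_bigr=> u _; apply/big_fset_incl => // v _ /mcoeff_outdom ->.
  by rewrite mulr0 monalgU0.
move=> u _ /mcoeff_outdom fu; rewrite big1 // => v _.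
by rewrite fu mul0r monalgU0.
Qed.

Lemma galg_mulC : commutative galg_mul.
Proof.
move=> f g; rewrite /galg_mul exchange_big /=; apply/eq_bigr => u _.
by apply/eq_bigr => v _; rewrite mulrC addrC.
Qed.

Lemma galg_mulDl : left_distributive galg_mul +%R.
Proof.
move=> f1 f2 g.
rewrite (@galg_mulw (msupp f1 `|` msupp f2) (msupp g) (f1 + f2)%R) ?msuppD_le //.
rewrite (@galg_mulw (msupp f1 `|` msupp f2) (msupp g) f1) ?fsubsetUl //.
rewrite (@galg_mulw (msupp f1 `|` msupp f2) (msupp g) f2) ?fsubsetUr //.
rewrite -big_split /=; apply/eq_bigr=> u _.
rewrite -big_split /=; apply/eq_bigr=> v _.
by rewrite mcoeffD mulrDl monalgUD.
Qed.

Lemma galg_mulDr : right_distributive galg_mul +%R.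
Proof. by move=> f g1 g2; rewrite !(galg_mulC f) galg_mulDl. Qed.

Lemma galg_mul0 : left_zero 0%R galg_mul.
Proof. by move=> f; rewrite /galg_mul msupp0 big_seq_fset0. Qed.

Lemma galg_mulr0 : right_zero 0%R galg_mul.
Proof. by move=> f; rewrite galg_mulC galg_mul0. Qed.

Lemma galg_mulUU (a b : K) (u v : G) :
  galg_mul << a *g u >> << b *g v >> = << a * b *g (u + v)%R >>.
Proof.
by rewrite (galg_mulw msuppU_le msuppU_le) !big_seq_fset1 !mcoeffUU.
Qed.

Lemma galg_mulUg (a : K) (u : G) (g : galg) :
  galg_mul << a *g u >> g = \sum_(v <- msupp g) << a * g@_v *g (u + v)%R >>.
Proof.
rewrite (galg_mulw msuppU_le (fsubset_refl _)) big_seq_fset1.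
by apply/eq_bigr => v _; rewrite mcoeffUU.
Qed.

Lemma galg_mul1 : left_id (gchar 0) galg_mul.
Proof.
move=> f; rewrite galg_mulUg [RHS]monalgE.
by apply/eq_bigr => u _; rewrite mul1r add0r.
Qed.

Lemma galg_mul_suml (I : Type) (r : seq I) (F : I -> galg) (g : galg) :
  galg_mul (\sum_(i <- r) F i) g = \sum_(i <- r) galg_mul (F i) g.
Proof.
exact: (big_morph (galg_mul^~ g) (fun _ _ => galg_mulDl _ _ _) (galg_mul0 _)).
Qed.

Lemma galg_mul_sumr (I : Type) (r : seq I) (F : I -> galg) (g : galg) :
  galg_mul g (\sum_(i <- r) F i) = \sum_(i <- r) galg_mul g (F i).
Proof.
exact: (big_morph (galg_mul g) (fun _ _ => galg_mulDr _ _ _) (galg_mulr0 _)).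
Qed.

Lemma galg_mulEl (f g : galg) :
  galg_mul f g = \sum_(u <- msupp f) galg_mul << f@_u *g u >> g.
Proof. by apply/eq_bigr => u _; rewrite galg_mulUg. Qed.

Lemma galg_mulEr (f g : galg) :
  galg_mul f g = \sum_(v <- msupp g) galg_mul f << g@_v *g v >>.
Proof.
by rewrite galg_mulC galg_mulEl; apply/eq_bigr => u _; rewrite galg_mulC.
Qed.

Lemma galg_mulA : associative galg_mul.
Proof.
move=> f g h; rewrite [LHS]galg_mulEl [in RHS](galg_mulEl f g).
rewrite [RHS]galg_mul_suml; apply/eq_bigr => u _.
rewrite (galg_mulEl g h) [in RHS](galg_mulEr _ g).
rewrite [LHS]galg_mul_sumr [RHS]galg_mul_suml; apply/eq_bigr => v _.
rewrite (galg_mulEr _ h) [RHS]galg_mulEr [LHS]galg_mul_sumr.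
by apply/eq_bigr => w _; rewrite !galg_mulUU mulrA addrA.
Qed.

Lemma galg_oner_neq0 : gchar 0 != 0%R.
Proof. by rewrite monalgU_eq0 oner_eq0. Qed.

HB.instance Definition _ := GRing.Zmodule_isComNzRing.Build galg
  galg_mulA galg_mulC galg_mul1 galg_mulDl galg_oner_neq0.

Lemma galg_scaleAl (c : K) (f g : galg) : c *: (f * g) = (c *: f) * g.
Proof.
have E (c0 : K) (h : galg) : c0 *: h = galg_mul << c0 *g 0%R >> h.
  by rewrite galg_mulUg; apply/eq_bigr => v _; rewrite add0r.
by rewrite !E; exact: mulrA.
Qed.

HB.instance Definition _ := GRing.Lmodule_isLalgebra.Build K galg galg_scaleAl.

End GroupAlgebra.

Section Fan.
Context {R : realType} {n : nat}.

(* N = Z^n as row vectors and M = Hom(N, Z) as column vectors. *)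
Definition pairing {K : pzRingType} (u : 'cV[K]_n) (x : 'rV[K]_n) : K :=
  (x *m u) 0 0.

Definition cone (s : seq 'rV[int]_n) : set 'rV[R]_n :=
  [set x | exists c : 'rV[int]_n -> R, (forall v, 0 <= c v) /\
     x = \sum_(v <- s) c v *: map_mx intr v].

Definition dual_cone (sigma : set 'rV[R]_n) : set 'cV[R]_n :=
  [set u | forall x, sigma x -> 0 <= pairing u x].

Definition cone_face (tau sigma : set 'rV[R]_n) : Prop :=
  exists u, dual_cone sigma u /\ tau = [set x | sigma x /\ pairing u x = 0].

Record is_fan (Delta : {fset (set 'rV[R]_n)}) : Prop := IsFan {
  fan_rational : forall sigma, sigma \in Delta -> exists s, sigma = cone s;
  fan_pointed : forall sigma, sigma \in Delta ->
    forall x, sigma x -> sigma (- x) -> x = 0;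
  fan_faces : forall sigma tau, sigma \in Delta -> cone_face tau sigma ->
    tau \in Delta;
  fan_inter : forall sigma tau, sigma \in Delta -> tau \in Delta ->
    cone_face (sigma `&` tau) sigma /\ cone_face (sigma `&` tau) tau }.

Definition smooth_fan (Delta : {fset (set 'rV[R]_n)}) : Prop :=
  forall sigma, sigma \in Delta ->
    exists (B : 'M[int]_n) (I : {set 'I_n}),
      B \in unitmx /\ sigma = cone [seq row i B | i <- enum I].

Definition complete_fan (Delta : {fset (set 'rV[R]_n)}) : Prop :=
  forall x : 'rV[R]_n, exists2 sigma, sigma \in Delta & sigma x.

Definition rays (Delta : {fset (set 'rV[R]_n)}) : {fset (set 'rV[R]_n)} :=
  [fset rho in Delta | `[< has_affdim rho 1 >]]%fset.

Definition primitive (v : 'rV[int]_n) : Prop :=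
  forall (d : nat) (w : 'rV[int]_n), v = w *+ d -> d = 1%N.

Definition prim_gen (rho : set 'rV[R]_n) : 'rV[int]_n :=
  xget 0 [set v | primitive v /\ rho = cone [:: v]].

Definition polytope (Delta : {fset (set 'rV[R]_n)}) : set 'cV[R]_n :=
  [set u | forall rho, rho \in rays Delta ->
     -1 <= pairing u (map_mx intr (prim_gen rho))].

Definition is_face (F P : set 'cV[R]_n) : Prop :=
  F !=set0 /\ exists w : 'rV[R]_n,
    F = [set u | P u /\ forall u', P u' -> pairing u w <= pairing u' w].

Definition has_codim (F : set 'cV[R]_n) (i : nat) : Prop :=
  exists d, has_affdim F d /\ (d + i = n)%N.

Definition relint (F : set 'cV[R]_n) : set 'cV[R]_n :=
  [set u | F u /\ \forall u' \near u, aff_hull F u' -> F u'].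

Definition Mreal (u : 'cV[int]_n) : 'cV[R]_n := map_mx intr u.

Section Subspaces.
Variables (Delta : {fset (set 'rV[R]_n)}) (u : 'cV[R]_n).

Definition active_rays : {fset (set 'rV[R]_n)} :=
  [fset rho in rays Delta | pairing u (map_mx intr (prim_gen rho)) == -1]%fset.

Definition Lspace : {vspace 'rV[R[i]]_n} :=
  <<[seq map_mx intr (prim_gen rho) | rho <- active_rays]>>%VS.

Definition iindex : nat := \dim Lspace.

Definition Nspace (k : nat) : set (ext R[i] n) :=
  if (iindex <= k)%N then
    extwedge (extpow iindex [set` Lspace]) (extpow (k - iindex) setT)
  else [set 0].

End Subspaces.

End Fan.

Section PolyvectorFields.
Variables (R : realType) (n : nat).

(* C[M], the coordinate ring of the torus T. *)
Definition torus_ring := galg R[i] 'cV[int]_n.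
HB.instance Definition _ := GRing.Lalgebra.on torus_ring.
HB.instance Definition _ := GRing.ComNzRing.on torus_ring.

(* A section of the k-th exterior power of the tangent bundle of T, given as
   the k-derivation of C[M] that it induces. *)
Definition kfield (k : nat) := ('I_k -> torus_ring) -> torus_ring.
HB.instance Definition _ k := GRing.Lmodule.on (kfield k).

Definition fscale {k} (a : torus_ring) (Theta : kfield k) : kfield k :=
  fun f => a * Theta f.

Definition wedge {k} (D : 'I_k -> torus_ring -> torus_ring) : kfield k :=
  fun f => \det (\matrix_(i < k, j < k) D i (f j)).

Definition derivation (D : torus_ring -> torus_ring) : Prop :=
  linear D /\ forall f g, D (f * g) = D f * g + f * D g.

(* C[sigma^vee /\ M], the coordinate ring of the affine chart U_sigma. *)
Definition chart_ring (sigma : set 'rV[R]_n) : set torus_ring :=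
  [set f | forall u, u \in msupp f -> dual_cone sigma (Mreal u)].

(* Derivations of the chart ring extend uniquely to its localization C[M]. *)
Definition chart_derivation (sigma : set 'rV[R]_n)
    (D : torus_ring -> torus_ring) : Prop :=
  derivation D /\ forall f, chart_ring sigma f -> chart_ring sigma (D f).

(* The sections over the affine chart U_sigma, restricted to T: the k-th
   exterior power of Der(A) over A, with A the chart ring. *)
Definition chart_sections (k : nat) (sigma : set 'rV[R]_n) : set (kfield k) :=
  [set Theta | exists (m : nat) (a : 'I_m -> torus_ring)
                 (D : 'I_m -> 'I_k -> torus_ring -> torus_ring),
    [/\ forall j, chart_ring sigma (a j),
        forall j i, chart_derivation sigma (D j i)
      & Theta = \sum_(j < m) fscale (a j) (wedge (D j))]].

(* H^0 of the k-th exterior power of the tangent sheaf of the toric variety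
   glued from the charts U_sigma: T is dense, so that a compatible family of
   sections over the charts is determined by its common restriction to T. *)
Definition global_sections (Delta : {fset (set 'rV[R]_n)}) (k : nat) :
    set (kfield k) :=
  [set Theta | forall sigma, sigma \in Delta -> chart_sections sigma Theta].

Definition rhoN1 (x : 'rV[R[i]]_n) (f : torus_ring) : torus_ring :=
  \sum_(u <- msupp f) << f@_u * pairing (map_mx intr u) x *g u >>.

(* The linear map with rhoN (x_1 /\ ... /\ x_k) = rhoN1 x_1 /\ ... /\ rhoN1 x_k,
   given on the basis e_{s_1} /\ ... /\ e_{s_k}, s_1 < ... < s_k. *)
Definition rhoN (k : nat) (xi : ext R[i] n) : kfield k :=
  \sum_(s : k.-tuple 'I_n | sorted ltn (map val s))
     (xi [set i in s]%SET : R[i]) *: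
       (wedge (fun i => rhoN1 (delta_mx 0 (tnth s i))) : kfield k).

Definition weight_space (Delta : {fset (set 'rV[R]_n)}) (k : nat)
    (u : 'cV[int]_n) : set (kfield k) :=
  [set fscale (gchar R[i] u) (@rhoN k xi) | xi in Nspace Delta (Mreal u) k].

End PolyvectorFields.

Arguments Mreal {R n} u.
Arguments global_sections {R n} Delta k.
Arguments weight_space {R n} Delta k u.

(* The convention that binom a b = 0 for b < 0. *)
Definition binom (a : nat) (b : int) : nat :=
  if b is Posz m then 'C(a, m) else 0%N.

(* Main.v *)
(* A polyvector field on the torus is a finite sum of fields chi^u
   rho_N(xi_u), so the question is which weights (u, xi_u) extend to X_Delta.
   Both sides are tested on characters. On chi^(m_1), ..., chi^(m_k) the field
   rho_N(xi) takes the value det-pairing of xi with (m_1, ..., m_k) times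
   chi^(m_1 + ... + m_k), where the pairing of x_1 /\ ... /\ x_k with (m_1,
   ..., m_k) is the determinant of the matrix of the <m_j, x_i> (Cauchy-
   Binet).

   Let v be the generator of a ray, completed to a basis of N. A section over
   the chart of that ray maps regular functions to regular functions;
   evaluated on the dual basis this forces <u, v> >= -1, and if <u, v> = -1
   that xi_u, as an alternating form on M, vanishes on the annihilator of v.
   Conversely, over a smooth cone with basis v_1, ..., v_n these conditions
   for its rays allow one to write chi^u rho_N(xi_u) as a combination of
   wedges of the chart derivations chi^(-m_i) rho_N(v_i). For all active rays
   together, vanishing on the annihilators of the v_rho means that xi_u lies
   in N_u^k: take a basis of N_C whose first i(u) vectors are active
   generators.

   For the count, a point u of P in the relative interior of a face F
   determines F, namely as the set of points of P on which all the
   inequalities active at u are equalities; the direction space of F is then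
   the orthogonal of L_u, so that codim F = i(u). Completeness of the fan
   makes P bounded. *)
Require Import Defs.
From HB Require Import structures.
From mathcomp Require Import all_boot all_order all_algebra.
From mathcomp Require Import perm ring lra zify.

Set Implicit Arguments.
Unset Strict Implicit.
Unset Printing Implicit Defensive.

Import Order.TTheory GRing.Theory Num.Theory.

Local Open Scope ring_scope.

(** * Cauchy-Binet *)

Notation increasing s := (sorted ltn (map val s)).

Section IncreasingTuples.
Variables (n k : nat).
Implicit Types s t : k.-tuple 'I_n.

Lemma increasing_tnth s :
  increasing s <-> (forall a b : 'I_k, (a < b)%N -> (tnth s a < tnth s b)%N).
Proof.
split=> [ss a b ab|H].
  have ka := ltn_ord a; have x0 := tnth s a.
  have := sorted_ltn_nth ltn_trans 0%N ss.
  move=> /(_ a b); rewrite !inE !size_map !size_tuple !ltn_ord => /(_ isT isT ab).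
  by rewrite !(nth_map x0) ?size_tuple ?ltn_ord // -!tnth_nth.
apply/(sortedP 0%N) => i; rewrite size_map size_tuple => ik.
have ik' := ltnW ik; have x0 := tnth s (Ordinal ik).
rewrite !(nth_map x0) ?size_tuple //.
by have := H (Ordinal ik') (Ordinal ik) (leqnn _); rewrite !(tnth_nth x0).
Qed.

Lemma increasing_uniq s : increasing s -> uniq s.
Proof.
move=> ss; rewrite -(map_inj_uniq val_inj).
by apply: sorted_uniq ss; [exact: ltn_trans | exact: ltnn].
Qed.

Lemma increasing_inj s : increasing s -> injective (tnth s).
Proof. by move=> /increasing_uniq us a b /(tuple_uniqP _ us). Qed.

Lemma increasing_mono s a b : increasing s -> (tnth s a < tnth s b)%N = (a < b)%N.
Proof.
move=> ss; have /increasing_tnth H := ss.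
case: (ltngtP a b) => [/H->|/H/ltnW|/val_inj->] //; last by rewrite ltnn.
by rewrite leqNgt => /negbTE.
Qed.

Lemma increasing_eq s t :
  increasing s -> increasing t -> [set i in s]%SET = [set i in t]%SET -> s = t.
Proof.
move=> ss st /setP est; apply/val_inj/(inj_map val_inj).
apply: (irr_sorted_eq ltn_trans ltnn ss st) => x.
apply/mapP/mapP => -[i is_ ->]; exists i => //; have := est i; rewrite !inE.
  by rewrite is_ => <-.
by rewrite is_ => ->.
Qed.

Lemma card_increasing s : increasing s -> #|[set i in s]%SET| = k.
Proof.
by move/increasing_uniq=> us; rewrite cardsE (card_uniqP us) size_tuple.
Qed.

(** Together with [increasing_eq] this identifies increasing [k]-tuples with [k]-subsets: sets index
    the exterior algebra, while tuples select the rows and columns of minors. *)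
Lemma increasing_enum (S : {set 'I_n}) : #|S| = k ->
  exists2 s : k.-tuple 'I_n, increasing s & S = [set i in s]%SET.
Proof.
move=> cS; have szS : size (enum S) == k by rewrite -cardE cS.
exists (Tuple szS); last by apply/setP=> i; rewrite inE /= mem_enum.
rewrite /=; have -> : enum S = [seq i <- enum 'I_n | i \in S] by rewrite enumT.
rewrite sorted_map; apply: sorted_filter; first by move=> x y z /=; exact: ltn_trans.
by rewrite -sorted_map val_enum_ord iota_ltn_sorted.
Qed.

End IncreasingTuples.

Section CauchyBinet.
Variables (R : comPzRingType) (k n : nat).

(** Multilinearity in the rows: [f] chooses, for each row [i] of the product, the summand
    [X i (f i)] times row [f i] of [M]. *)
Lemma det_mulmx_ffun (X : 'M[R]_(k, n)) (M : 'M[R]_(n, k)) :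
  \det (X *m M) =
  \sum_(f : {ffun 'I_k -> 'I_n}) (\prod_i X i (f i)) * \det (rowsub f M).
Proof.
rewrite [LHS]/determinant.
transitivity (\sum_(f : {ffun 'I_k -> 'I_n}) \sum_(s : 'S_k)
   (-1) ^+ s * ((\prod_i X i (f i)) * \prod_i M (f i) (s i))).
  rewrite exchange_big; apply: eq_bigr => s _; rewrite -big_distrr /=; congr (_ * _).
  under eq_bigr do rewrite mxE.
  rewrite bigA_distr_bigA /=; apply: eq_bigr => f _.
  by rewrite -big_split.
apply: eq_bigr => f _; rewrite /determinant big_distrr; apply: eq_bigr => s _ /=.
rewrite mulrCA; congr (_ * (_ * _)); apply: eq_bigr => i _.
by rewrite mxE.
Qed.

(** A non-injective choice [f] repeats a row of [M] and contributes nothing. The injective choices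
    are grouped by their sorted values [s]; over each [s] they are the composites of [tnth s] with a
    permutation, and summing over the permutations gives the minor of [X]. *)
Theorem Cauchy_Binet (X : 'M[R]_(k, n)) (M : 'M[R]_(n, k)) :
  \det (X *m M) = \sum_(s : k.-tuple 'I_n | increasing s)
    \det (colsub (tnth s) X) * \det (rowsub (tnth s) M).
Proof.
rewrite det_mulmx_ffun (bigID (fun f : {ffun 'I_k -> 'I_n} => injectiveb f)) /=.
rewrite [X in _ + X]big1 ?addr0; last first.
  move=> f /injectivePn[a [b ab fab]].
  by rewrite (determinant_alternate ab) ?mulr0 // => j; rewrite !mxE fab.
pose key (f : {ffun 'I_k -> 'I_n}) := sort_tuple (relpre val leq) (mktuple f).
rewrite (partition_big key (fun s => increasing s)) /=; last first.
  move=> f injf; rewrite ltn_sorted_uniq_leq (map_inj_uniq val_inj) sort_uniq.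
  by rewrite [X in X && _]injf sorted_map sort_sorted // => x y; exact: leq_total.
apply: eq_bigr => s ss.
pose h (p : 'S_k) : {ffun 'I_k -> 'I_n} := [ffun i => tnth s (p i)].
have hinj : injective h.
  move=> p q /ffunP E; apply/permP => i; have := E i; rewrite !ffunE.
  exact: increasing_inj.
transitivity (\sum_(f in [set h p | p in [set: 'S_k]%SET]%SET)
                (\prod_i X i (f i)) * \det (rowsub f M)).
  apply: eq_bigl => f; apply/andP/imsetP => [[/injectiveP injf /eqP fs]|[p _ ->]].
    have : perm_eq (mktuple f) s by rewrite -fs /= perm_sym perm_sort.
    case/tuple_permP => p Ep; exists p => //.
    apply/ffunP => i; rewrite ffunE; have := congr1 (fun t => nth (f i) t i) Ep.
    by rewrite -!tnth_nth !tnth_mktuple.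
  split; first by apply/injectiveP => a b; rewrite !ffunE => /(increasing_inj ss)/perm_inj.
  apply/eqP/val_inj/(inj_map val_inj).
  apply: (irr_sorted_eq ltn_trans ltnn _ ss) => [|x].
    rewrite ltn_sorted_uniq_leq (map_inj_uniq val_inj) sort_uniq map_inj_uniq ?enum_uniq //=.
      by rewrite sorted_map sort_sorted // => x y; exact: leq_total.
    by move=> a b; rewrite !ffunE => /(increasing_inj ss)/perm_inj.
  move: x; apply: eq_mem_map => x; rewrite mem_sort; apply/tnthP/tnthP => -[a ->].
    by exists (p a); rewrite tnth_mktuple ffunE.
  by exists (p^-1%g a); rewrite tnth_mktuple ffunE permKV.
rewrite big_imset /=; last by move=> p q _ _; exact: hinj.
rewrite [\det (colsub _ _)]/determinant big_distrl /=.
apply: eq_big => [p|p _]; first by rewrite inE.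
(* Permuting the selected rows of [M] costs the sign of [p], which is the sign in the Leibniz
   formula for the minor of [X]. *)
have -> : rowsub (h p) M = row_perm p (rowsub (tnth s) M).
  by apply/matrixP => i j; rewrite !mxE ffunE.
rewrite row_permE det_mulmx det_perm mulrA; congr (_ * _); rewrite mulrC.
by congr (_ * _); apply: eq_bigr => i _; rewrite !mxE ffunE.
Qed.

End CauchyBinet.

(** * The exterior algebra *)

Section ExteriorAlgebraTheory.
Variables (K : fieldType) (n : nat).
Local Notation ext := (ext K n).
Implicit Types (a b c : ext) (S T A B : {set 'I_n}).

(** The comprehension inside [ninv] is a classical set; here it becomes a finite set, to which the
    cardinality lemmas for finite sets apply. *)
Lemma ninvE A B : ninv A B =
  #|[set p : 'I_n * 'I_n | [&& p.1 \in A, p.2 \in B & (p.2 < p.1)%N]]%SET|.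
Proof. by apply: eq_card => p; rewrite inE /in_mem /= /classical_sets.in_set boolp.asboolb. Qed.

Lemma ninvUl A B (C : {set 'I_n}) : [disjoint A & B] -> ninv (A :|: B) C = (ninv A C + ninv B C)%N.
Proof.
move=> dAB; rewrite !ninvE -cardsUI [X in (_ + X)%N]eq_card0 ?addn0; last first.
  move=> -[i j]; rewrite !inE /=; apply/negbTE/negP.
  by case/andP=> /and3P[iA _ _] /and3P[iB _ _]; rewrite (disjointFr dAB) in iB.
apply: eq_card => -[i j]; rewrite !inE /=.
by rewrite andb_orl.
Qed.

Lemma ninvUr A B (C : {set 'I_n}) : [disjoint B & C] -> ninv A (B :|: C) = (ninv A B + ninv A C)%N.
Proof.
move=> dBC; rewrite !ninvE -cardsUI [X in (_ + X)%N]eq_card0 ?addn0; last first.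
  move=> -[i j]; rewrite !inE /=; apply/negbTE/negP.
  by case/andP=> /and3P[_ jB _] /and3P[_ jC _]; rewrite (disjointFr dBC) in jC.
apply: eq_card => -[i j]; rewrite !inE /=.
by do !case: (_ \in _); case: (j < i)%N.
Qed.

Lemma ninv0s A : ninv set0 A = 0%N.
Proof. by rewrite ninvE; apply: eq_card0 => -[i j]; rewrite !inE. Qed.

Lemma ninvs0 A : ninv A set0 = 0%N.
Proof. by rewrite ninvE; apply: eq_card0 => -[i j]; rewrite !inE andbF. Qed.

Lemma extmulE a b S : extmul a b S = \sum_(A : {set 'I_n} | A \subset S)
  (-1) ^+ ninv A (S :\: A) * (a A * b (S :\: A)).
Proof. by rewrite ffunE. Qed.

(** Both sides sum over the ordered partitions of [S] into three parts; [F A B] is the term for the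
    parts [A], [B] and the rest. The signs agree because [ninv] is additive over disjoint unions in
    either argument. *)
Lemma extmulA : associative (@extmul K n).
Proof.
move=> a b c; apply/ffunP => S; rewrite !extmulE.
pose F A B := (-1) ^+ ninv A B * (-1) ^+ ninv (A :|: B) (S :\: (A :|: B))
   * (a A * b B * c (S :\: (A :|: B))) : K.
transitivity (\sum_(A : {set 'I_n} | A \subset S)
   \sum_(B : {set 'I_n} | B \subset S :\: A) F A B).
  apply: eq_bigr => A AS; rewrite extmulE !big_distrr /=; apply: eq_bigr => B BS.
  have [BsS dAB] : B \subset S /\ [disjoint A & B].
    by move: BS; rewrite subsetD disjoint_sym => /andP[].
  rewrite /F setDDl ninvUl //.
  have -> : S :\: A = B :|: S :\: (A :|: B).
    apply/setP=> i; have := subsetP BS i; rewrite !inE.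
    by case: (i \in A); case: (i \in B); case: (i \in S) => // /(_ isT).
  rewrite ninvUr; last first.
    by rewrite -setI_eq0; apply/eqP/setP => i; rewrite !inE; do !case: (i \in _).
  by rewrite !exprD; ring.
rewrite pair_big_dep /=.
transitivity (\sum_(B : {set 'I_n} | B \subset S)
   \sum_(A : {set 'I_n} | A \subset B) F A (B :\: A)); last first.
  apply: eq_bigr => B BS; rewrite extmulE big_distrl !big_distrr /=.
  apply: eq_bigr => A AB; rewrite /F.
  have -> : A :|: B :\: A = B.
    apply/setP => i; have := subsetP AB i; rewrite !inE.
    by case: (i \in A); case: (i \in B) => // /(_ isT).
  by ring.
rewrite pair_big_dep /=.
(* The outer set [A :|: B] with inner set [A] on the right corresponds to the pair [A], [B] on the
   left. *)
rewrite [RHS](reindex_onto (fun p => (p.1 :|: p.2, p.1))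
  (fun p => (p.2, p.1 :\: p.2))) /=; last first.
  by case=> B A /= /andP[BS AB]; rewrite -{1}(setIidPr AB) setID.
apply: eq_big => -[A B] /=.
  rewrite xpair_eqE eqxx setDUl setDv set0U subUset subsetUl subsetD /= andbT -andbA.
  congr [&& _, _ & _].
  by apply/setDidPl/eqP.
case/andP => _; rewrite subsetD setDUl setDv set0U => /andP[_ dBA].
by rewrite (setDidPl dBA).
Qed.

Lemma extmulDl a b c : extmul (a + b) c = extmul a c + extmul b c.
Proof.
apply/ffunP => S; rewrite [RHS]ffunE !extmulE -big_split; apply: eq_bigr => A _.
by rewrite ffunE /= mulrDl mulrDr.
Qed.

Lemma extmulDr a b c : extmul a (b + c) = extmul a b + extmul a c.
Proof.
apply/ffunP => S; rewrite [RHS]ffunE !extmulE -big_split; apply: eq_bigr => A _.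
by rewrite ffunE /= mulrDr mulrDr.
Qed.

Lemma extmulZl (x : K) a b : extmul (x *: a) b = x *: extmul a b.
Proof.
apply/ffunP => S; rewrite [RHS]ffunE !extmulE scaler_sumr; apply: eq_bigr => A _.
by rewrite ffunE /= /GRing.scale /=; ring.
Qed.

Lemma extmulZr (x : K) a b : extmul a (x *: b) = x *: extmul a b.
Proof.
apply/ffunP => S; rewrite [RHS]ffunE !extmulE scaler_sumr; apply: eq_bigr => A _.
by rewrite ffunE /= /GRing.scale /=; ring.
Qed.

Lemma extmul_suml m (x : 'I_m -> K) (F : 'I_m -> ext) a :
  extmul (\sum_i x i *: F i) a = \sum_i x i *: extmul (F i) a.
Proof.
elim: m x F => [|m IH] x F; last by rewrite !big_ord_recl extmulDl extmulZl IH.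
by rewrite !big_ord0; have := extmulZl 0 0 a; rewrite !scale0r.
Qed.

Lemma extmul_sumr m (x : 'I_m -> K) (F : 'I_m -> ext) a :
  extmul a (\sum_i x i *: F i) = \sum_i x i *: extmul a (F i).
Proof.
elim: m x F => [|m IH] x F; last by rewrite !big_ord_recl extmulDr extmulZr IH.
by rewrite !big_ord0; have := extmulZr 0 a 0; rewrite !scale0r.
Qed.

Lemma ext1mul : left_id (@ext1 K n) (@extmul K n).
Proof.
move=> a; apply/ffunP => S; rewrite extmulE (bigD1 set0) ?sub0set //=.
rewrite ninv0s ffunE eqxx setD0 !mul1r big1 ?addr0 // => A /andP[_ /negbTE A0].
by rewrite ffunE A0 mul0r mulr0.
Qed.

Lemma extmul1 : right_id (@ext1 K n) (@extmul K n).
Proof.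
move=> a; apply/ffunP => S; rewrite extmulE (bigD1 S) //=.
rewrite setDv ninvs0 ffunE eqxx mulr1 mul1r big1 ?addr0 // => A /andP[AS ne].
rewrite ffunE; case: eqP => [SA|_]; last by rewrite !mulr0.
by case/eqP: ne; apply/eqP; rewrite eqEsubset AS -setD_eq0 SA eqxx.
Qed.

HB.instance Definition _ :=
  Monoid.isLaw.Build _ (@ext1 K n) (@extmul K n) extmulA ext1mul extmul1.

(** Since [extvec v] is supported on singletons, only these contribute. The result has the shape of
    a Laplace expansion along one row, as needed in [extprodE]. *)
Lemma extmul_vecl (v : 'rV[K]_n) a S : extmul (extvec v) a S =
  \sum_(i in S) (-1) ^+ ninv [set i] (S :\ i) * (v 0 i * a (S :\ i)).
Proof.
rewrite extmulE.
transitivity (\sum_(A : {set 'I_n} | A \subset S) \sum_(i | A == [set i]%SET)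
   (-1) ^+ ninv [set i] (S :\ i) * (v 0 i * a (S :\ i))).
  apply: eq_bigr => A _; rewrite ffunE big_distrl big_distrr /=.
  by apply: eq_bigr => i /eqP ->.
rewrite (exchange_big_dep (fun i => i \in S)) /=.
  apply: eq_bigr => i iS; rewrite (bigD1 [set i]%SET) /=; last by rewrite sub1set iS eqxx.
  by rewrite big1 ?addr0 // => A /andP[/andP[_ ->]].
by move=> A i AS /eqP EA; rewrite -sub1set -EA.
Qed.

End ExteriorAlgebraTheory.

Definition extprod (K : fieldType) n k (x : 'I_k -> 'rV[K]_n) : ext K n :=
  \big[@extmul K n/ext1 K n]_(i < k) extvec (x i).

(** * Coordinates of wedge products as minors *)

Section Minors.
Variables (K : fieldType) (n : nat).

Definition homog (k : nat) (a : ext K n) :=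
  forall S : {set 'I_n}, #|S| != k -> a S = 0.

Lemma homogD k a b : homog k a -> homog k b -> homog k (a + b).
Proof. by move=> ha hb S Sk; rewrite ffunE /= ha ?hb ?addr0. Qed.

Lemma homogZ k c a : homog k a -> homog k (c *: a).
Proof. by move=> ha S Sk; rewrite ffunE /= ha // scaler0. Qed.

Lemma homog_sum k (I : Type) (r : seq I) (P : pred I) (F : I -> ext K n) :
  (forall i, P i -> homog k (F i)) -> homog k (\sum_(i <- r | P i) F i).
Proof.
move=> h; elim/big_rec: _ => [S _|i a Pi ha]; first by rewrite ffunE.
exact: homogD (h _ Pi) ha.
Qed.

Lemma extprod_homog k (x : 'I_k -> 'rV[K]_n) : homog k (extprod x).
Proof.
elim: k x => [|k IH] x S Sk.
  by rewrite /extprod big_ord0 ffunE; move: Sk; rewrite cards_eq0 => /negbTE->.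
rewrite /extprod big_ord_recl extmul_vecl big1 // => i iS.
rewrite IH ?mulr0 //; move: Sk; rewrite (cardsD1 i) iS; apply: contra => /eqP.
by move=> <-.
Qed.

(** Induction on [k]: splitting off the first factor by [extmul_vecl] matches the cofactor expansion
    along the first row, one term for each position [p] of the removed index. *)
Lemma extprodE k (x : 'I_k -> 'rV[K]_n) (s : k.-tuple 'I_n) : increasing s ->
  extprod x [set i in s]%SET = \det (\matrix_(i, j) x i 0 (tnth s j)).
Proof.
elim: k x s => [|k IH] x s ss.
  rewrite /extprod big_ord0 ffunE det_mx00; case: eqP => // -[].
  by apply/setP => i; rewrite !inE tuple0.
rewrite /extprod big_ord_recl extmul_vecl (expand_det_row _ ord0).
have sinj := increasing_inj ss.
transitivity (\sum_(i in [set tnth s p | p in [set: 'I_k.+1]%SET]%SET)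
  (-1) ^+ ninv [set i] ([set i in s]%SET :\ i) *
  (x ord0 0 i * extprod (fun a => x (lift ord0 a)) ([set i in s]%SET :\ i))).
  apply: eq_bigl => i; rewrite inE; apply/tnthP/imsetP => -[p].
    by move=> ->; exists p.
  by move=> _ ->; exists p.
rewrite big_imset /=; last by move=> a b _ _; exact: sinj.
apply: eq_big => [p|p _]; first by rewrite inE.
rewrite mxE mulrCA; congr (_ * _).
pose s' := mktuple (fun j => tnth s (lift p j)).
have ss' : increasing s'.
  apply/increasing_tnth => a b ab; rewrite !tnth_mktuple increasing_mono //=.
  by rewrite ltnNge leq_bump2 -ltnNge.
have -> : [set i in s]%SET :\ tnth s p = [set i in s']%SET.
  apply/setP => i; rewrite !inE; apply/andP/tnthP => [[ip /tnthP[q Eq]]|[q ->]].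
    have pq : p != q by apply: contra ip => /eqP->; rewrite Eq.
    by case/unlift_some: pq => j Ej _; exists j; rewrite tnth_mktuple -Ej.
  by rewrite tnth_mktuple mem_tnth (inj_eq sinj) eq_sym neq_lift.
rewrite IH // /cofactor; congr (_ * _); last first.
  by congr (\det _); apply/matrixP => a b; rewrite !mxE tnth_mktuple.
congr (_ ^+ _).
(* Exactly the first [p] entries of [s] lie below the entry at position [p], so the number of
   inversions is the exponent [0 + p] of the cofactor sign. *)
rewrite add0n ninvE.
transitivity #|[set (tnth s p, tnth s (lift p q)) | q : 'I_k & (lift p q < p)%N]%SET|.
  apply: eq_card => -[i j]; rewrite !inE /=; apply/and3P/imsetP => [[/eqP-> /tnthP[q ->]]|[q qp [-> ->]]].
    by rewrite tnth_mktuple increasing_mono // => qp; exists q; rewrite ?inE.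
  rewrite inE in qp; split=> //; last by rewrite increasing_mono.
  by apply/tnthP; exists q; rewrite tnth_mktuple.
rewrite card_imset; last by move=> a b [/sinj/lift_inj].
have le_pk : (p <= k)%N by rewrite -ltnS.
have winj : injective (widen_ord le_pk) by move=> a b /(congr1 val)/= /val_inj.
rewrite -[RHS]card_ord -(card_imset _ winj).
apply: eq_card => q; rewrite inE; apply/idP/imsetP => [|[j _ ->]]; rewrite /= /bump.
  by case: (leqP p q) => [pq|qp _]; [rewrite ltnNge (leqW pq) | exists (Ordinal qp) => //; apply: val_inj].
by rewrite (leqNgt p) ltn_ord /= add0n.
Qed.

End Minors.

(** * The determinant pairing and dual bases *)

Section Pairing.
Variables (K : fieldType) (n k : nat).
Implicit Types (a : ext K n) (M : 'M[K]_(n, k)) (v : 'rV[K]_n).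

(** The pairing of the degree [k] part of [a] with the wedge of the columns of [M], written through
    minors so that it is visibly linear in [a]. On a wedge product it is a single determinant, by
    [extpair_extprod]. *)
Definition extpair M a : K :=
  \sum_(s : k.-tuple 'I_n | increasing s) a [set i in s] * \det (rowsub (tnth s) M).

Lemma extpair_sum (I : Type) (r : seq I) (P : pred I) (c : I -> K) (F : I -> ext K n) M :
  extpair M (\sum_(i <- r | P i) c i *: F i) = \sum_(i <- r | P i) c i * extpair M (F i).
Proof.
under [RHS]eq_bigr do rewrite /extpair big_distrr.
rewrite exchange_big; apply: eq_bigr => s _; rewrite sum_ffunE big_distrl.
by apply: eq_bigr => i _; rewrite ffunE /= mulrA.
Qed.

Lemma extpair_extprod M (x : 'I_k -> 'rV[K]_n) :
  extpair M (extprod x) = \det ((\matrix_i x i) *m M).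
Proof.
rewrite Cauchy_Binet; apply: eq_bigr => s ss; rewrite extprodE //.
by congr (\det _ * _); apply/matrixP => i j; rewrite !mxE.
Qed.

(** If [s] and [t] differ, some entry of [s] is missing from [t], both having [k] distinct entries,
    and it gives a zero row. *)
Lemma det_mxsub1 (s t : k.-tuple 'I_n) : increasing s -> increasing t ->
  \det (mxsub (tnth s) (tnth t) 1%:M : 'M[K]_k) = (s == t)%:R.
Proof.
move=> ss st; case: eqP => [<-|nst].
  rewrite -[RHS](det1 K k); congr (\det _); apply/matrixP => i j.
  by rewrite !mxE (inj_eq (increasing_inj ss)).
have [a ta] : exists a : 'I_k, tnth s a \notin t.
  apply/existsP; apply: contra_notT nst; rewrite negb_exists => /forallP H.
  apply: increasing_eq => //; apply/eqP.
  rewrite eqEcard !card_increasing // leqnn andbT; apply/subsetP => i.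
  by rewrite !inE => /tnthP[a ->]; have := H a; rewrite negbK.
rewrite (expand_det_row _ a) big1 // => j _; rewrite !mxE; case: eqP => [E|].
  by rewrite E mem_tnth in ta.
by rewrite mul0r.
Qed.

Variable B : 'M[K]_n.
Hypothesis Bunit : B \in unitmx.

Definition rowprod (s : k.-tuple 'I_n) : ext K n := extprod (fun j => row (tnth s j) B).

(** The columns of [invmx B] are the basis dual to the rows of [B], so their wedges are dual to the
    wedges of the rows. *)
Lemma extpair_rowprod (s t : k.-tuple 'I_n) : increasing s -> increasing t ->
  extpair (colsub (tnth s) (invmx B)) (rowprod t) = (t == s)%:R.
Proof.
move=> ss st; rewrite extpair_extprod -det_mxsub1 //.
have -> : \matrix_i row (tnth t i) B = rowsub (tnth t) B.
  by apply/matrixP => i j; rewrite !mxE.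
by rewrite -mxsub_mul mulmxV.
Qed.

(** The identity is inserted as [invmx B *m B] into the coordinates of [a], and Cauchy-Binet splits
    each of its minors: the minors of [invmx B] assemble into the dual coefficients, those of [B]
    are the coordinates of the products. *)
Lemma ext_expand a : homog k a ->
  a = \sum_(s : k.-tuple 'I_n | increasing s)
         extpair (colsub (tnth s) (invmx B)) a *: rowprod s.
Proof.
move=> ha; apply/ffunP => S; rewrite sum_ffunE.
have [/increasing_enum[t st ->]|Sk] := eqVneq #|S| k; last first.
  by rewrite ha // big1 // => s _; rewrite ffunE /= extprod_homog ?scaler0.
transitivity (\sum_(u : k.-tuple 'I_n | increasing u) a [set i in u] *
   \det (rowsub (tnth u) (invmx B) *m colsub (tnth t) B)).
  rewrite (bigD1 t) //= big1 ?addr0 => [|u /andP[su nut]].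
    rewrite -mxsub_mul mulVmx // det_mxsub1 //.
    by rewrite eqxx mulr1.
  rewrite -mxsub_mul mulVmx // det_mxsub1 //.
  by rewrite (negbTE nut) mulr0.
under eq_bigr do rewrite Cauchy_Binet big_distrr.
rewrite exchange_big; apply: eq_bigr => s ss; rewrite ffunE /= /GRing.scale /=.
rewrite extprodE // big_distrl; apply: eq_bigr => u su /=.
rewrite mulrA; congr (_ * _ * _); congr (\det _); first by rewrite -mxsubrc -mxsubcr.
by apply/matrixP => i j; rewrite !mxE.
Qed.

(* A k-vector, seen as an alternating form on the dual space, vanishes on the
   annihilator of v. For v != 0 this says that v divides the k-vector. *)
Definition annihilated v a := forall M, v *m M = 0 -> extpair M a = 0.

(** Every dual vector of index other than [p] vanishes on row [p] of [B], so a selection [s] without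
    [p] lies in the annihilator of that row. *)
Lemma annihilated_coef p a (s : k.-tuple 'I_n) : annihilated (row p B) a ->
  p \notin s -> extpair (colsub (tnth s) (invmx B)) a = 0.
Proof.
move=> ka ps; apply: ka; rewrite mulmx_colsub -row_mul mulmxV //.
apply/matrixP => i j; rewrite !mxE; case: eqP => // E.
by rewrite E mem_tnth in ps.
Qed.

(** The vector [c] is a left null vector of the matrix of pairings. The case [v = 0] is included:
    then [c] is a linear relation among the [x i], and the product pairs to 0 with everything. *)
Lemma annihilated_extprod v (x : 'I_k -> 'rV[K]_n) (c : 'rV[K]_k) :
  c != 0 -> v = \sum_i c 0 i *: x i -> annihilated v (extprod x).
Proof.
move=> c0 -> M vM; rewrite extpair_extprod; apply/eqP/det0P; exists c => //.
rewrite mulmxA (mulmx_sum_row c) -vM; congr (_ *m _); apply: eq_bigr => i _.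
by rewrite rowK.
Qed.

Lemma annihilated_sum (I : Type) (r : seq I) (P : pred I) (c : I -> K) (F : I -> ext K n) v :
  (forall i, P i -> annihilated v (F i)) -> annihilated v (\sum_(i <- r | P i) c i *: F i).
Proof.
move=> kF M vM; rewrite extpair_sum big1 // => i Pi.
by rewrite kF ?mulr0.
Qed.

Lemma annihilated_rowprod p (s : k.-tuple 'I_n) : p \in s ->
  annihilated (row p B) (rowprod s).
Proof.
case/tnthP => b ->; apply: (@annihilated_extprod _ _ (delta_mx 0 b)).
  by apply/eqP => /rowP/(_ b); rewrite !mxE !eqxx => /eqP; rewrite oner_eq0.
rewrite (bigD1 b) //= mxE !eqxx scale1r big1 ?addr0 // => j jb.
by rewrite mxE (negbTE jb) andbF scale0r.
Qed.

End Pairing.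

Lemma row_free_complete (K : fieldType) (r n : nat) (A : 'M[K]_(r, n)) : row_free A ->
  exists2 B : 'M[K]_n, B \in unitmx &
    forall (i : 'I_r) (p : 'I_n), p = i :> nat -> row p B = row i A.
Proof.
move=> fA; have rn : (r <= n)%N by rewrite -(eqP fA) rank_leq_col.
move: A fA; rewrite -(subnKC rn); move: (n - r)%N => m A fA {n rn}.
(* A row free [A] is [col_ebase A] times the first [r] rows of [row_ebase A]; bordering
   [col_ebase A] by an identity block makes the product square and invertible without changing these
   rows. *)
exists (block_mx (col_ebase A) 0 0 1%:M *m row_ebase A).
  by rewrite unitmx_mul row_ebase_unit andbT unitmxE det_ublock det1 mulr1 -unitmxE col_ebase_unit.
move=> i p pi; have -> : p = lshift m i by apply: val_inj.
rewrite row_mul /block_mx rowKu -row_mul; congr row.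
rewrite -[RHS]mulmx_ebase (eqP fA); congr (_ *m _).
by rewrite -[X in row_mx X 0]mulmx1 -(mulmx0 _ (col_ebase A)) -mul_mx_row -pid_mx_row.
Qed.

(* These imports come this late because they shadow many names of finset. *)
From mathcomp Require Import finmap complex monalg.
From mathcomp Require Import boolp classical_sets functions cardinality.
From mathcomp Require Import fsbigop reals topology normedtype.

Import numFieldNormedType.Exports.

Local Open Scope classical_set_scope.

(** * Linear spans and exterior powers of subspaces *)

Section LinearSpan.
Context {K : fieldType} {V : lmodType K}.
Implicit Types (S W : set V).

Lemma lspan_mem S x : S x -> lspan S x.
Proof.
move=> Sx; exists 1%N, (fun=> 1), (fun=> x); split=> //.
by rewrite big_ord1 scale1r.
Qed.

Lemma lspan0 S : lspan S 0.
Proof. by exists 0%N, (fun=> 0), (fun=> 0); split; [case | rewrite big_ord0]. Qed.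

Lemma lspanZ S c x : lspan S x -> lspan S (c *: x).
Proof.
case=> m [d [s [Ss ->]]]; exists m, (fun i => c * d i), s; split=> //.
by rewrite scaler_sumr; apply: eq_bigr => i _; rewrite scalerA.
Qed.

Lemma lspanD S x y : lspan S x -> lspan S y -> lspan S (x + y).
Proof.
case=> m [c [s [Ss ->]]] [p [d [t [St ->]]]].
exists (m + p)%N, (fun i => match fintype.split i with inl a => c a | inr a => d a end),
  (fun i => match fintype.split i with inl a => s a | inr a => t a end); split.
  by move=> i; case: fintype.split.
rewrite big_split_ord /=; congr (_ + _); apply: eq_bigr => i _.
  by case: (splitP (lshift p i)) => [j|j /= E]; [move=> /= /val_inj-> | have := ltn_ord i; lia].
by case: (splitP (rshift m i)) => [j /= E|j /addnI/val_inj-> //]; have := ltn_ord j; lia.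
Qed.

Lemma lspan_sum S (I : Type) (r : seq I) (P : pred I) (F : I -> V) :
  (forall i, P i -> lspan S (F i)) -> lspan S (\sum_(i <- r | P i) F i).
Proof. by move=> SF; elim/big_rec: _ => [|i x /SF ? ?]; [exact: lspan0 | exact: lspanD]. Qed.

End LinearSpan.

Lemma linear_fun_sum (K : pzRingType) (V W : lmodType K) (f : V -> W) (I : Type)
    (r : seq I) (c : I -> K) (F : I -> V) : linear f ->
  f (\sum_(i <- r) c i *: F i) = \sum_(i <- r) c i *: f (F i).
Proof.
move=> lf; have f0 : f 0 = 0 by have := lf (-1) 0 0; rewrite !scaleN1r oppr0 addr0 addNr.
by elim: r => [|i r IH]; rewrite ?big_nil // !big_cons lf IH.
Qed.

Lemma lspan_linear (K : fieldType) (V W : lmodType K) (f : V -> W) (S : set V) (T : set W) :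
  linear f -> (forall x, S x -> lspan T (f x)) -> forall x, lspan S x -> lspan T (f x).
Proof.
move=> lf ST x [m [c [s [Ss ->]]]]; rewrite (linear_fun_sum _ _ _ lf).
by apply: lspan_sum => i _; apply: lspanZ; exact: ST.
Qed.

Section LinearSpan.
Context {K : fieldType} {V : lmodType K}.
Implicit Types (S W : set V).

Lemma lspan_le S T : S `<=` lspan T -> lspan S `<=` lspan T.
Proof. by move=> ST x; apply: (lspan_linear (f := id)) => //; exact: ST. Qed.

Lemma lspan_rangeP (I : finType) (b : I -> V) x :
  lspan (range b) x <-> exists c : I -> K, x = \sum_i c i *: b i.
Proof.
split=> [|[c ->]]; last first.
  by apply: lspan_sum => i _; apply/lspanZ/lspan_mem; exists i.
case=> m [c [s [Ss ->]]].
have /choice[f fE] : forall j, exists i, s j = b i.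
  by move=> j; have [i _ <-] := Ss j; exists i.
(* A generator may occur several times in the given combination; its coefficient collects all
   occurrences. *)
exists (fun i => \sum_(j | f j == i) c j).
under [RHS]eq_bigr do rewrite scaler_suml.
rewrite (exchange_big_dep predT) //=; apply: eq_bigr => j _.
by rewrite (eq_bigl (pred1 (f j))) => [|i]; rewrite ?big_pred1_eq ?fE // eq_sym.
Qed.

(** Permits bases indexed by any finite type, such as sets of tuples or tagged pairs, by renumbering
    through [enum_val]. *)
Lemma has_dim_fin (I : finType) (b : I -> V) W :
  (forall c : I -> K, \sum_i c i *: b i = 0 -> forall i, c i = 0) ->
  (forall x, W x <-> exists c : I -> K, x = \sum_i c i *: b i) ->
  has_dim W #|I|.
Proof.
move=> indep spanW; pose e : 'I_#|I| -> I := enum_val; exists (b \o e); split.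
  move=> c c0 i; rewrite -(enum_valK i).
  apply: (indep (c \o enum_rank)); rewrite -[RHS]c0.
  rewrite (reindex e) /=; last exact/onW_bij/enum_val_bij.
  by apply: eq_bigr => j _; rewrite enum_valK.
have -> : range (b \o e) = range b.
   apply/predeqP => x; split=> [[i _ <-]|[i _ <-]]; first by exists (e i).
  by exists (enum_rank i) => //=; rewrite /e enum_rankK.
by apply/predeqP => x; split; [move/spanW => ?; apply/lspan_rangeP | move/lspan_rangeP/spanW].
Qed.

End LinearSpan.

Section RowSpan.
Variables (K : fieldType) (n : nat).

Lemma free_row_free m (A : 'M[K]_(m, n)) : row_free A -> free [tuple row i A | i < m].
Proof.
move=> fA; apply/freeP => c c0 i.
have : (\row_j c j) *m A = 0.
  rewrite mulmx_sum_row -[RHS]c0; apply: eq_bigr => j _.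
  by rewrite mxE (nth_map j) ?size_enum_ord // nth_ord_enum.
by rewrite -(mul0mx _ A) => /(row_free_inj fA)/rowP/(_ i); rewrite !mxE.
Qed.

Lemma mem_span_rows m (A : 'M[K]_(m, n)) v :
  (v <= A)%MS -> v \in <<[tuple row i A | i < m]>>%VS.
Proof.
case/submxP => c ->; rewrite mulmx_sum_row; apply: memv_suml => i _.
by apply: memvZ; apply: memv_span; apply/tnthP; exists i; rewrite tnth_mktuple.
Qed.

Lemma dim_span_rows m (A : 'M[K]_(m, n)) :
  \dim <<[tuple row i A | i < m]>>%VS = \rank A.
Proof.
set f := maxrankfun A.
have fA : row_free (rowsub f A) by exact: maxrowsub_free.
have := free_row_free fA; rewrite /free size_tuple => /eqP <-; congr (\dim _).
apply/eqP; rewrite eqEsubv; apply/andP; split; apply/span_subvP => v /tnthP[i ->].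
  rewrite tnth_mktuple; apply: mem_span_rows.
  by rewrite (submx_trans (row_sub i A)) // eq_maxrowsub.
rewrite tnth_mktuple row_rowsub; apply: memv_span; apply/tnthP.
by exists (f i); rewrite tnth_mktuple.
Qed.

(** A maximal free subfamily of [X] is completed to a basis. Applied to the active generators, it
    gives the basis adapted to [Lspace]. *)
Lemma span_basis_complete (X : seq 'rV[K]_n) : exists2 B : 'M[K]_n, B \in unitmx &
  forall p : 'I_n, (p < \dim <<X>>%VS)%N -> row p B \in X.
Proof.
pose A : 'M[K]_(size X, n) := \matrix_i X`_i.
have XE : [tuple row i A | i < size X] = X :> seq _.
  apply: (@eq_from_nth _ 0); rewrite size_tuple // => j jX.
  by rewrite -[j]/(val (Ordinal jX)) -tnth_nth tnth_mktuple rowK.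
have rX : \dim <<X>>%VS = \rank A by rewrite -dim_span_rows XE.
have [B Bu BE] := row_free_complete (maxrowsub_free A).
exists B => // p; rewrite rX => pr; rewrite (BE (Ordinal pr)) // row_rowsub.
by rewrite rowK mem_nth.
Qed.

End RowSpan.

(** * Multiples of the top exterior power of a subspace *)

Section PowerSpace.
Variables (K : fieldType) (n : nat).
Implicit Types (L : {vspace 'rV[K]_n}).

(** [Nspace] with an arbitrary subspace in the place of [Lspace]; the two agree by conversion. *)
Definition powspace (k : nat) L : set (ext K n) :=
  if (\dim L <= k)%N
  then extwedge (extpow (\dim L) [set` L]) (extpow (k - \dim L) setT)
  else [set 0].

Lemma extprod_cat p q (x : 'I_p -> 'rV[K]_n) (y : 'I_q -> 'rV[K]_n) :
  extmul (extprod x) (extprod y) =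
  extprod (fun i : 'I_(p + q) => match fintype.split i with inl a => x a | inr b => y b end).
Proof.
rewrite [RHS]/extprod big_split_ord /=; congr extmul; apply: eq_bigr => i _.
  by case: (splitP (lshift q i)) => [j /= /val_inj-> //|j /= E]; have := ltn_ord i; lia.
by case: (splitP (rshift p i)) => [j /= E|j /addnI/val_inj-> //]; have := ltn_ord j; lia.
Qed.

(** Either the [x i] are free, hence a basis of [L] by dimension, and [v] is a combination of them,
    or they satisfy a nontrivial relation. Both outcomes fit the hypotheses of
    [annihilated_extprod]. *)
Lemma span_relation L (x : 'I_(\dim L) -> 'rV[K]_n) v : (forall i, x i \in L) ->
  v \in L -> v != 0 -> exists c : 'rV[K]_(\dim L), c != 0 /\
    (v = \sum_i c 0 i *: x i \/ 0 = \sum_i c 0 i *: x i).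
Proof.
move=> xL vL v0; set A := \matrix_i x i.
have AE (c : 'rV_(\dim L)) : \sum_i c 0 i *: x i = c *m A.
  by rewrite mulmx_sum_row; apply: eq_bigr => i _; rewrite rowK.
have [fA|nfA] := boolP (row_free A); last first.
  move: nfA; rewrite -kermx_eq0 => /rowV0Pn[c /sub_kermxP cA c0].
  by exists c; split=> //; right; rewrite AE cA.
pose t := [tuple row i A | i < \dim L].
have tL : (<<t>> == L)%VS.
  rewrite eqEdim (eqP (free_row_free fA)) size_tuple leqnn andbT.
  by apply/span_subvP => w /tnthP[i ->]; rewrite tnth_mktuple rowK.
have vt : v \in <<t>>%VS by rewrite (eqP tL).
exists (\row_i coord t i v); have vE : v = \sum_i (\row_i coord t i v) 0 i *: x i.
  rewrite {1}(coord_span vt); apply: eq_bigr => i _; rewrite mxE.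
  by rewrite -tnth_nth tnth_mktuple rowK.
split; last by left.
by apply: contra v0 => /eqP c0; rewrite vE big1 // => i _; rewrite c0 mxE scale0r.
Qed.

Lemma powspace_annihilated k L a : powspace k L a ->
  homog k a /\ forall v, v \in L -> v != 0 -> annihilated k v a.
Proof.
rewrite /powspace; case: leqP => [|_ ->]; last first.
  split=> [S _|v _ _ M _]; first by rewrite ffunE.
  by rewrite /extpair big1 // => s _; rewrite ffunE mul0r.
move=> /subnKC; move: (k - _)%N => q <-{k} aLq.
(* [P] is stable under linear combinations, which reduces the claim to a product of vectors of [L]
   followed by arbitrary ones. *)
pose P (b : ext K n) := homog (\dim L + q) b /\ forall v, v \in L -> v != 0 -> annihilated (\dim L + q) v b.
have Psum m (c : 'I_m -> K) (b : 'I_m -> ext K n) :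
    (forall i, P (b i)) -> P (\sum_i c i *: b i).
  move=> Pb; split=> [|v vL v0].
    by apply: homog_sum => i _; apply: homogZ; case: (Pb i).
  by apply: annihilated_sum => i _; case: (Pb i) => _; exact.
have [m [c [b [bE ->]]]] := aLq; apply: (Psum) => i.
have [w [z [[p [d [w' [w'L ->]]]] [p' [d' [z' [z'L ->]]]] ->]]] := bE i.
rewrite extmul_suml; apply: (Psum) => j; rewrite extmul_sumr; apply: (Psum) => l.
have [x [xL ->]] := w'L j; have [y [_ ->]] := z'L l.
rewrite -/(extprod x) -/(extprod y) extprod_cat; split; first exact: extprod_homog.
move=> v vL v0; have [u [u0 uE]] := span_relation xL vL v0.
have wE : \sum_a u 0 a *: x a = \sum_a (row_mx u (0 : 'rV_q)) 0 a *:
    match fintype.split a with inl b => x b | inr b => y b end.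
  rewrite big_split_ord /= [X in _ + X]big1 ?addr0 => [|e _]; last first.
    by rewrite row_mxEr mxE scale0r.
  apply: eq_bigr => e _; rewrite row_mxEl.
  by case: (splitP (lshift q e)) => [h /= /val_inj-> //|h /= E]; have := ltn_ord e; lia.
have u'0 : row_mx u (0 : 'rV_q) != 0 by rewrite row_mx_eq0 negb_and u0.
case: uE => uE; rewrite wE in uE; first exact: annihilated_extprod uE.
(* The factors in [L] are dependent: the product is annihilated for the zero vector, that is, on
   every [M]. *)
move=> M vM; apply: (annihilated_extprod u'0 uE); exact: mul0mx.
Qed.

(** Entry [a] of an increasing tuple is at least [a], so the value [j] occurs at a position [a] not
    beyond [j]; by induction an earlier position already holds its own smaller index. *)
Lemma increasing_initial k r (s : k.-tuple 'I_n) : increasing s ->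
  (forall p : 'I_n, (p < r)%N -> p \in s) -> (r <= n)%N ->
  forall j : 'I_k, (j < r)%N -> tnth s j = j :> nat.
Proof.
move=> ss rs rn j; have [m] := ubnP (j : nat); elim: m j => // m IH j jm jr.
have jle (a : 'I_k) : (a <= tnth s a)%N.
  case: a => a; elim: a => // a IHa ak.
  apply: leq_ltn_trans (IHa (ltnW ak)) _.
  by rewrite increasing_mono.
have /rs/tnthP[a Ea] : (Ordinal (leq_trans jr rn) < r)%N by [].
have {}Ea : tnth s a = j :> nat by rewrite -Ea.
have := jle a; rewrite Ea leq_eqVlt => /predU1P[/val_inj aj|aj]; first by rewrite -aj Ea aj.
have am : (a < m)%N by exact: leq_trans aj jm.
by have := IH a am (ltn_trans aj jr); rewrite Ea => E; rewrite -E ltnn in aj.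
Qed.

(** In the expansion along [B] only those [s] survive that contain every index below [\dim L]. By
    [increasing_initial] such a product starts with the rows of [B] that lie in [L]. For [k] below
    [\dim L] there is no such [s], and [a] is 0. *)
Lemma annihilated_powspace k L (B : 'M[K]_n) a : B \in unitmx ->
  (forall p : 'I_n, (p < \dim L)%N -> row p B \in L) ->
  homog k a -> (forall p : 'I_n, (p < \dim L)%N -> annihilated k (row p B) a) ->
  powspace k L a.
Proof.
move=> Bu BL ha ka.
have Ln : (\dim L <= n)%N by have := dimvS (subvf L); rewrite dimvf /dim /= mul1n.
pose P (s : k.-tuple 'I_n) := [forall p : 'I_n, (p < \dim L)%N ==> (p \in s)].
have aE : a = \sum_(s : k.-tuple 'I_n | increasing s && P s)
   extpair (colsub (tnth s) (invmx B)) a *: rowprod B s.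
  rewrite {1}(ext_expand Bu ha) (bigID P) /= [X in _ + X]big1 ?addr0 // => s /andP[ss].
  rewrite negb_forall => /existsP[p]; rewrite negb_imply => /andP[pL ps].
  by rewrite (annihilated_coef Bu (ka p pL) ps) scale0r.
rewrite /powspace; case: leqP => [Lk|kL]; last first.
  rewrite aE big_pred0 // => s; apply/negbTE; apply: contraL kL.
  case/andP=> ss /forallP Ps; rewrite -leqNgt.
  have := card_increasing ss => <-.
  have winj : injective (widen_ord Ln) by move=> p q /(congr1 val)/= /val_inj.
  rewrite -[X in (X <= _)%N]card_ord -(card_imset predT winj); apply: subset_leq_card.
  apply/fintype.subsetP => _ /imsetP[p _ ->]; rewrite inE.
  exact: (implyP (Ps (widen_ord Ln p)) (ltn_ord p)).
rewrite aE; apply: lspan_sum => s /andP[ss /forallP Ps]; apply/lspanZ/lspan_mem.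
have {}Ps (p : 'I_n) : (p < \dim L)%N -> p \in s by exact/implyP/Ps.
have sE := increasing_initial ss Ps Ln.
rewrite /rowprod; move: s ss Ps sE {aE P ka ha a}.
rewrite -(subnKC Lk); set q := (k - _)%N.
rewrite [X in (X - _)%N](subnKC Lk) -/q => s ss Ps sE.
exists (extprod (fun j => row (tnth s (lshift q j)) B)),
       (extprod (fun j => row (tnth s (rshift (\dim L) j)) B)); split.
- apply: lspan_mem; exists (fun j => row (tnth s (lshift q j)) B); split=> // i.
  by apply: BL; rewrite sE /=.
- by apply: lspan_mem; exists (fun j => row (tnth s (rshift (\dim L) j)) B).
rewrite extprod_cat; apply: eq_bigr => i _; congr extvec.
by case: splitP => j E; congr (row (tnth s _) B); apply: val_inj.
Qed.

End PowerSpace.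

(** * The coordinate ring of the torus and its polyvector fields *)

Lemma monalgU_scale (K : fieldType) (G : zmodType) (c : K) (u : G) :
  << c *g u >> = c *: gchar K u.
Proof. by apply/malgP => w; rewrite mcoeffZ !mcoeffU mulr_natr. Qed.

Fact torus_key : unit. Proof. exact: tt. Qed.

(* Locked copies of gchar and rhoN1: unification would otherwise unfold them
   against the operations of the group algebra, and diverge. *)
Definition chr (R : realType) n : 'cV[int]_n -> torus_ring R n :=
  locked_with torus_key (@gchar R[i] 'cV[int]_n).

Definition rho (R : realType) n : 'rV[R[i]]_n -> torus_ring R n -> torus_ring R n :=
  locked_with torus_key (@rhoN1 R n).

Lemma gchar_chr (R : realType) n : @gchar R[i] 'cV[int]_n = @chr R n.
Proof. by rewrite /chr locked_withE. Qed.

Lemma rhoN1_rho (R : realType) n : @rhoN1 R n = @rho R n.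
Proof. by rewrite /rho locked_withE. Qed.

Section TorusRing.
Variables (R : realType) (n : nat).
Local Notation C := R[i].
Local Notation T := (torus_ring R n).
Local Notation M := 'cV[int]_n.
Local Notation chr := (@chr R n).
Implicit Types (f g : T) (u w : M).

Lemma galg_eq f g : (forall u, f@_u = g@_u) -> f = g.
Proof. by move/malgP. Qed.

Lemma gcoefD f g u : (f + g)@_u = f@_u + g@_u.
Proof. exact: mcoeffD. Qed.

Lemma gcoef0 u : (0 : T)@_u = 0.
Proof. exact: mcoeff0. Qed.

Lemma gcoefZ (c : C) f u : (c *: f)@_u = c * f@_u.
Proof. exact: mcoeffZ. Qed.

Lemma gcoef_sum (I : Type) (r : seq I) (P : pred I) (F : I -> T) u :
  (\sum_(i <- r | P i) F i)@_u = \sum_(i <- r | P i) (F i)@_u.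
Proof. exact: (big_morph (mcoeff u) (fun f g => gcoefD f g u) (gcoef0 u)). Qed.

Lemma gcoef_chr u w : (chr u)@_w = (u == w)%:R.
Proof. by rewrite -gchar_chr; exact: mcoeffU. Qed.

Lemma chr0 : chr (0 : M) = 1.
Proof. by rewrite -gchar_chr. Qed.

Lemma chrD u w : chr (u + w) = chr u * chr w.
Proof. by rewrite -gchar_chr; apply/esym; rewrite [LHS]galg_mulUU mulr1. Qed.

Lemma chr_sum (I : Type) (r : seq I) (P : pred I) (F : I -> M) :
  chr (\sum_(i <- r | P i) F i) = \prod_(i <- r | P i) chr (F i).
Proof. exact: (big_morph _ chrD chr0). Qed.

Lemma galgE f : f = \sum_(u <- msupp f) f@_u *: chr u.
Proof.
by rewrite {1}[f]monalgE; apply: eq_bigr => u _; rewrite -gchar_chr; exact: monalgU_scale.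
Qed.

Lemma galgEw (d : {fset M}) f : (msupp f `<=` d)%fset ->
  f = \sum_(u <- d) f@_u *: chr u.
Proof.
move=> fd; rewrite {1}[f]galgE (big_fset_incl _ fd) // => u _ /mcoeff_outdom ->.
by rewrite scale0r.
Qed.

Lemma galg_scaleAr (c : C) f g : f * (c *: g) = c *: (f * g).
Proof. by rewrite mulrC -scalerAl mulrC. Qed.

Lemma gcoef_chrM u f w : (chr u * f)@_w = f@_(w - u).
Proof.
rewrite {1}[f]galgE mulr_sumr gcoef_sum [f in RHS]galgE gcoef_sum.
apply: eq_bigr => v _; rewrite galg_scaleAr -chrD !gcoefZ !gcoef_chr.
by congr (_ * _%:R); rewrite [v == _]eq_sym subr_eq eq_sym addrC.
Qed.

End TorusRing.

Section TorusFields.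
Variables (R : realType) (n : nat).
Local Notation C := R[i].
Local Notation T := (torus_ring R n).
Local Notation M := 'cV[int]_n.
Local Notation chr := (@chr R n).
Local Notation rho := (@rho R n).
Implicit Types (f g : T) (u m : M) (x : 'rV[C]_n).

Definition cpair m x : C := pairing (map_mx intr m) x.

Lemma cpairE m x : cpair m x = \sum_i x 0 i * (m i 0)%:~R.
Proof. by rewrite /cpair /pairing mxE; apply: eq_bigr => i _; rewrite mxE. Qed.

Lemma cpairDl m1 m2 x : cpair (m1 + m2) x = cpair m1 x + cpair m2 x.
Proof. by rewrite /cpair /pairing map_mxD mulmxDr mxE. Qed.

Lemma cpair_sumr (I : finType) (c : I -> C) (y : I -> 'rV[C]_n) m :
  cpair m (\sum_i c i *: y i) = \sum_i c i * cpair m (y i).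
Proof.
rewrite /cpair /pairing mulmx_suml summxE; apply: eq_bigr => i _.
by rewrite -scalemxAl mxE.
Qed.

Lemma gcoef_rho x f u : (rho x f)@_u = f@_u * cpair u x.
Proof.
rewrite -rhoN1_rho.
rewrite gcoef_sum; under eq_bigr do rewrite mcoeffU.
have [uf|uf] := boolP (u \in msupp f); last first.
  rewrite (mcoeff_outdom uf) mul0r big_seq big1 // => v vf; case: eqP => // E.
  by rewrite E (negbTE uf) in vf.
rewrite (big_fsetD1 u) //= eqxx big1_fset ?addr0 // => v.
by rewrite !inE => /andP[/negbTE->].
Qed.

Lemma rho_chr x m : rho x (chr m) = cpair m x *: chr m.
Proof.
apply: galg_eq => u; rewrite gcoef_rho gcoefZ gcoef_chr mulrC.
by case: eqP => [->|]; rewrite ?mulr0.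
Qed.

Lemma rho_linear x : linear (rho x).
Proof.
move=> c f g; apply: galg_eq => u.
by rewrite gcoefD gcoefZ !gcoef_rho gcoefD gcoefZ mulrDl mulrA.
Qed.

Lemma rho_sum (I : finType) (c : I -> C) (y : I -> 'rV[C]_n) f :
  rho (\sum_i c i *: y i) f = \sum_i c i *: rho (y i) f.
Proof.
apply: galg_eq => u; rewrite gcoef_rho cpair_sumr gcoef_sum mulr_sumr.
by apply: eq_bigr => i _; rewrite gcoefZ gcoef_rho mulrCA.
Qed.

Definition charmx k (m : 'I_k -> M) : 'M[C]_(n, k) := \matrix_(i, j) (m j i 0)%:~R.

Lemma cpair_charmx k (m : 'I_k -> M) (x : 'I_k -> 'rV[C]_n) :
  \matrix_(i, j) cpair (m j) (x i) = (\matrix_i x i) *m charmx m.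
Proof.
apply/matrixP => i j; rewrite !mxE cpairE; apply: eq_bigr => l _.
by rewrite !mxE.
Qed.

(** Column [j] of the matrix is a column of constants times the character of [m j], and these
    characters factor out of the determinant. *)
Lemma wedge_chr k (x : 'I_k -> 'rV[C]_n) (m : 'I_k -> M) :
  wedge (fun i => rho (x i)) (fun j => chr (m j)) =
  \det ((\matrix_i x i) *m charmx m) *: chr (\sum_j m j).
Proof.
rewrite /wedge -cpair_charmx.
have -> : \matrix_(i, j) rho (x i) (chr (m j)) =
    map_mx (in_alg T) (\matrix_(i, j) cpair (m j) (x i)) *m diag_mx (\row_j chr (m j)).
  by apply/matrixP => i j; rewrite mul_mx_diag !mxE rho_chr /= -scalerAl mul1r.
rewrite det_mulmx det_map_mx det_diag /= -scalerAl mul1r chr_sum.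
by congr (_ *: _); apply: eq_bigr => j _; rewrite mxE.
Qed.

Definition stdprod k (s : k.-tuple 'I_n) : kfield R n k :=
  wedge (fun i => rho (delta_mx 0 (tnth s i))).

Lemma rhoNE k (xi : ext C n) (f : 'I_k -> T) : @rhoN R n k xi f =
  \sum_(s : k.-tuple 'I_n | increasing s) xi [set i in s]%SET *: stdprod s f.
Proof. by rewrite /rhoN rhoN1_rho fct_sumE. Qed.

Lemma rhoN_chr k (xi : ext C n) (m : 'I_k -> M) :
  rhoN xi (fun j => chr (m j)) = extpair (charmx m) xi *: chr (\sum_j m j).
Proof.
rewrite rhoNE /extpair scaler_suml; apply: eq_bigr => s ss.
have -> : rowsub (tnth s) (charmx m) =
    (\matrix_i delta_mx (0 : 'I_1) (tnth s i)) *m charmx m.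
  by apply/row_matrixP => i; rewrite row_mul rowK -rowE row_rowsub.
rewrite /stdprod.
rewrite wedge_chr.
exact: scalerA.
Qed.

End TorusFields.

(** Serves for the logarithmic derivative [D (chr u) * chr (- u)], which is additive in [u] and so
    determined by the standard basis of $M$. *)
Lemma additive_cV (V : zmodType) (n : nat) (h : 'cV[int]_n -> V) :
  (forall u w, h (u + w) = h u + h w) ->
  forall u, h u = \sum_l h (delta_mx l 0) *~ u l 0.
Proof.
move=> hD u.
have h0 : h 0 = 0 by apply: (addrI (h 0)); rewrite -hD !addr0.
have hN w : h (- w) = - h w by apply: (addrI (h w)); rewrite -hD !subrr.
have hMn w p : h (w *+ p) = h w *+ p.
  by elim: p => [|p IH]; rewrite ?mulr0n // !mulrS hD IH.
have hMz w (z : int) : h (z *: w) = h w *~ z.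
  have hMp (p : nat) : h (p%:Z *: w) = h w *~ p.
    by rewrite -[in LHS]natz scaler_nat hMn pmulrn.
  by case: z => p; rewrite ?NegzE ?scaleNr ?hN hMp // mulrNz.
have hsum (I : Type) (r : seq I) (F : I -> 'cV[int]_n) :
    h (\sum_(i <- r) F i) = \sum_(i <- r) h (F i).
  exact: (big_morph h hD h0).
have -> : u = \sum_l u l 0 *: delta_mx l 0.
  by rewrite {1}[u]matrix_sum_delta; apply: eq_bigr => l _; rewrite big_ord1.
rewrite hsum; apply: eq_bigr => l _; rewrite hMz; congr (_ *~ _).
rewrite summxE (bigD1 l) //= !mxE !eqxx mulr1 big1 ?addr0 // => p pl.
by rewrite !mxE eq_sym (negbTE pl) mulr0.
Qed.

Lemma det_scale_rows (A : comPzRingType) k (g : 'I_k -> A) (X : 'M[A]_k) :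
  \det (\matrix_(i, j) (g i * X i j)) = (\prod_i g i) * \det X.
Proof.
have -> : \matrix_(i, j) (g i * X i j) = diag_mx (\row_i g i) *m X.
  by apply/matrixP => i j; rewrite mul_diag_mx !mxE.
by rewrite det_mulmx det_diag; congr (_ * _); apply: eq_bigr => i _; rewrite mxE.
Qed.

(** Additivity of the logarithmic derivative: [a] and [b] stand for the derivatives of [c1] and
    [c2], whose inverses are [d1] and [d2]. *)
Lemma leibniz_ratio (A : comPzRingType) (a b c1 c2 d1 d2 : A) :
  c1 * d1 = 1 -> c2 * d2 = 1 -> (a * c2 + c1 * b) * (d1 * d2) = a * d1 + b * d2.
Proof.
move=> e1 e2; transitivity (a * d1 * (c2 * d2) + b * d2 * (c1 * d1)); first by ring.
by rewrite e1 e2 !mulr1.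
Qed.

(** * Polyvector fields as sums of weight components *)

Section Fields.
Variables (R : realType) (n : nat).
Local Notation C := R[i].
Local Notation T := (torus_ring R n).
Local Notation M := 'cV[int]_n.
Local Notation chr := (@chr R n).
Local Notation rho := (@rho R n).
Implicit Types (f g : T) (u m : M) (x : 'rV[C]_n).

(** Cauchy-Binet over the coordinate ring: [rhoN], defined on the standard basis, is the exterior
    extension of [rho] on arbitrary vectors. *)
Lemma wedge_rhoN k (x : 'I_k -> 'rV[C]_n) :
  wedge (fun i => rho (x i)) = rhoN (extprod x) :> kfield R n k.
Proof.
apply/funext => f; rewrite rhoNE /wedge.
pose N := \matrix_(l, j) rho (delta_mx 0 l) (f j).
have -> : \matrix_(i, j) rho (x i) (f j) = map_mx (in_alg T) (\matrix_i x i) *m N.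
  apply/matrixP => i j; rewrite !mxE {1}[x i]row_sum_delta rho_sum.
  by apply: eq_bigr => l _; rewrite !mxE mulr_algl.
have NE s : stdprod s f = \det (rowsub (tnth s) N).
  by congr (\det _); apply/matrixP => i j; rewrite !mxE.
rewrite Cauchy_Binet; apply: eq_bigr => s ss; rewrite extprodE // NE.
have -> : colsub (tnth s) (map_mx (in_alg T) (\matrix_i x i)) =
    map_mx (in_alg T) (\matrix_(i, j) x i 0 (tnth s j)).
  by apply/matrixP => i j; rewrite !mxE.
by rewrite [X in X * _]det_map_mx [LHS]mulr_algl.
Qed.

Lemma rhoN_sum k (I : Type) (r : seq I) (P : pred I) (c : I -> C) (F : I -> ext C n)
    (f : 'I_k -> T) :
  rhoN (\sum_(i <- r | P i) c i *: F i) f = \sum_(i <- r | P i) c i *: rhoN (F i) f.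
Proof.
rewrite rhoNE; under [RHS]eq_bigr do rewrite rhoNE scaler_sumr.
rewrite exchange_big; apply: eq_bigr => s _; rewrite sum_ffunE scaler_suml.
by apply: eq_bigr => i _; rewrite ffunE; exact/esym/scalerA.
Qed.

Lemma wedge_scale k (g : 'I_k -> T) (D : 'I_k -> T -> T) :
  wedge (fun j f => g j * D j f) = fscale (\prod_j g j) (wedge D) :> kfield R n k.
Proof.
apply/funext => f; rewrite /fscale /wedge -det_scale_rows.
set X := (X in \det X = _); set Y := (X in _ = \det X).
suff -> : X = Y by [].
apply/matrixP => i j; rewrite [LHS]mxE [RHS]mxE.
by apply: (congr1 (GRing.mul _)); rewrite mxE.
Qed.

(** On characters the logarithmic derivative of [D] is additive in the weight, so [D] is a
    combination of the invariant fields of the standard basis; linearity extends this to all [f]. *)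
Lemma derivation_expand (D : T -> T) f : derivation D ->
  D f = \sum_l D (chr (delta_mx l 0)) * chr (- delta_mx l 0) * rho (delta_mx 0 l) f.
Proof.
case=> Dlin Dmul.
have Dchr u : D (chr u) =
    \sum_l D (chr (delta_mx l 0)) * chr (- delta_mx l 0) * rho (delta_mx 0 l) (chr u).
  pose h w := D (chr w) * chr (- w).
  have hD w1 w2 : h (w1 + w2) = h w1 + h w2.
    rewrite /h opprD !chrD Dmul; apply: leibniz_ratio; rewrite -chrD addrN; exact: chr0.
  have -> : D (chr u) = h u * chr u.
    by rewrite /h -mulrA -chrD addNr chr0 mulr1.
  rewrite (additive_cV hD) mulr_suml; apply: eq_bigr => l _; rewrite rho_chr.
  have -> : cpair u (delta_mx 0 l : 'rV[C]_n) = (u l 0)%:~R.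
    rewrite cpairE (bigD1 l) //= !mxE !eqxx mul1r big1 ?addr0 // => p pl.
    by rewrite !mxE (negbTE pl) andbF mul0r.
  by rewrite galg_scaleAr scaler_int mulrzAl.
rewrite [f in LHS]galgE (linear_fun_sum _ _ _ Dlin).
under eq_bigr do rewrite Dchr scaler_sumr.
rewrite exchange_big /=; apply: eq_bigr => l _; rewrite [f in RHS]galgE.
have -> : rho (delta_mx 0 l) (\sum_(u <- msupp f) f@_u *: chr u) =
    \sum_(u <- msupp f) f@_u *: rho (delta_mx 0 l) (chr u).
  exact: linear_fun_sum (rho_linear _).
by rewrite mulr_sumr; apply: eq_bigr => u _; rewrite galg_scaleAr.
Qed.

Lemma wedge_derivations k (D : 'I_k -> T -> T) : (forall i, derivation (D i)) ->
  wedge D = \sum_(s : k.-tuple 'I_n | increasing s) fscale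
    (\det (\matrix_(i, j) (D i (chr (delta_mx (tnth s j) 0)) * chr (- delta_mx (tnth s j) 0))))
    (stdprod s) :> kfield R n k.
Proof.
move=> derD; apply/funext => f; rewrite fct_sumE /wedge.
pose N := \matrix_(l, j) rho (delta_mx 0 l) (f j).
pose G := \matrix_(i, l) (D i (chr (delta_mx l 0)) * chr (- delta_mx l 0)).
have -> : \matrix_(i, j) D i (f j) = G *m N.
  apply/matrixP => i j; rewrite !mxE (derivation_expand _ (derD i)).
  by apply: eq_bigr => l _; rewrite !mxE.
have NE s : stdprod s f = \det (rowsub (tnth s) N).
  by congr (\det _); apply/matrixP => i j; rewrite !mxE.
rewrite Cauchy_Binet; apply: eq_bigr => s ss; rewrite /fscale NE.
set G' := (X in \det X * _ = _); set G'' := (X in _ = \det X * _).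
by have -> : G' = G'' by apply/matrixP => i j; rewrite !mxE.
Qed.

Definition weighted k (U : {fset M}) (a : M -> ext C n) : kfield R n k :=
  \sum_(u <- U) fscale (chr u) (rhoN (a u)).

(** Regrouping by weight: the coordinate of [a u] at the set of [s] is the coefficient of $\chi^u$
    in [h s], and [U] contains the supports of all [h s]. *)
Lemma stdprod_weighted k (h : k.-tuple 'I_n -> T) : exists (U : {fset M}) a,
  (forall u, homog k (a u)) /\
  \sum_(s : k.-tuple 'I_n | increasing s) fscale (h s) (stdprod s) = weighted U a.
Proof.
pose U := \big[fsetU/fset0]_(s : k.-tuple 'I_n) msupp (h s).
pose a u : ext C n := [ffun S : {set 'I_n} =>
  \sum_(s : k.-tuple 'I_n | increasing s && (S == [set i in s]%SET)) (h s)@_u : C^o].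
exists U, a; split=> [u S Sk|].
  rewrite ffunE big_pred0 // => s; apply: contraNF Sk => /andP[ss /eqP->].
  by rewrite card_increasing.
have aE u (s : k.-tuple 'I_n) : increasing s -> a u [set i in s]%SET = (h s)@_u.
  move=> ss; rewrite ffunE (big_pred1 s) // => t /=.
  by apply/andP/eqP => [[st /eqP/increasing_eq->]|->].
apply/funext => f; rewrite /weighted !fct_sumE.
under [RHS]eq_bigr do rewrite /fscale rhoNE mulr_sumr.
rewrite exchange_big /=; apply: eq_bigr => s ss.
have hU : (msupp (h s) `<=` U)%fset by apply: bigfcup_sup.
rewrite /fscale {1}(galgEw hU) mulr_suml; apply: eq_bigr => u _.
rewrite (aE u s ss) [RHS]galg_scaleAr; apply/esym; exact: scalerAl.
Qed.

(** On characters the component of weight [w] contributes only to the exponent [w + \sum_j m j], so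
    one coefficient isolates [a u]. *)
Lemma weighted_chr k U a (m : 'I_k -> M) u : u \in U ->
  (weighted U a (fun j => chr (m j)))@_(u + \sum_j m j) = extpair (charmx R m) (a u).
Proof.
move=> uU; rewrite /weighted fct_sumE gcoef_sum.
have E w : (fscale (chr w) (rhoN (a w)) (fun j => chr (m j)))@_(u + \sum_j m j) =
    extpair (charmx R m) (a w) * (w == u)%:R.
  by rewrite /fscale rhoN_chr galg_scaleAr gcoefZ -chrD gcoef_chr (inj_eq (addIr _)).
rewrite (eq_bigr (fun w => extpair (charmx R m) (a w) * (w == u)%:R)); last by move=> w _; exact: E.
rewrite (big_fsetD1 u) //= eqxx mulr1 big1_fset ?addr0 // => w.
by rewrite !inE => /andP[/negbTE-> _] _; rewrite mulr0.
Qed.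

End Fields.

(** * Affine charts *)

Section Charts.
Variables (R : realType) (n : nat).
Local Notation C := R[i].
Local Notation T := (torus_ring R n).
Local Notation M := 'cV[int]_n.
Local Notation chr := (@chr R n).
Local Notation rho := (@rho R n).
Implicit Types (f g : T) (u m w : M) (x : 'rV[C]_n).

Lemma pairing_sumr (K : pzRingType) (I : Type) (r : seq I) (P : pred I) (c : I -> K)
    (y : I -> 'rV[K]_n) (u : 'cV[K]_n) :
  pairing u (\sum_(i <- r | P i) c i *: y i) = \sum_(i <- r | P i) c i * pairing u (y i).
Proof.
rewrite /pairing mulmx_suml summxE; apply: eq_bigr => i _.
by rewrite -scalemxAl mxE.
Qed.

Lemma pairingDl (K : pzRingType) (u w : 'cV[K]_n) (x : 'rV[K]_n) :
  pairing (u + w) x = pairing u x + pairing w x.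
Proof. by rewrite /pairing mulmxDr mxE. Qed.

Lemma pairing_intr (K : pzRingType) (u : M) (v : 'rV[int]_n) :
  pairing (map_mx intr u) (map_mx intr v) = (pairing u v)%:~R :> K.
Proof. by rewrite /pairing -map_mxM mxE. Qed.

Lemma dual_cone_lattice (s : seq 'rV[int]_n) u :
  dual_cone (cone s) (Mreal u : 'cV[R]_n) <-> forall v, v \in s -> 0 <= pairing u v.
Proof.
split=> [du v vs|H x [c [c0 ->]]]; last first.
  rewrite pairing_sumr big_seq sumr_ge0 // => v vs.
  by rewrite mulr_ge0 // pairing_intr ler0z H.
(* A multiple of [v]: repetitions in [s] multiply it by the number of occurrences, which is
   positive. *)
have := du (\sum_(y <- s) (y == v)%:R *: map_mx intr y).
rewrite pairing_sumr => H.
have {H} : 0 <= \sum_(y <- s) (y == v)%:R * pairing (Mreal u : 'cV[R]_n) (map_mx intr y).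
  by apply: H; exists (fun y => (y == v)%:R); split.
rewrite (eq_bigr (fun y => if y == v then (pairing u v)%:~R : R else 0)); last first.
  by move=> y _; case: eqP => [->|]; rewrite ?mul0r // mul1r pairing_intr.
rewrite -big_mkcond big_const_seq iter_addr addr0 pmulrn_lge0 ?ler0z //.
by rewrite -has_count; apply/hasP; exists v.
Qed.

Lemma chart_ringP (sigma : set 'rV[R]_n) f :
  chart_ring sigma f <-> forall u, f@_u != 0 -> dual_cone sigma (Mreal u).
Proof. by split=> H u; [rewrite mcoeff_neq0 | rewrite -mcoeff_neq0]; exact: H. Qed.

Section ChartRing.
Variable sigma : set 'rV[R]_n.

Lemma chart_ring_chr u : chart_ring sigma (chr u) <-> dual_cone sigma (Mreal u).
Proof.
split=> [/chart_ringP/(_ u)|du].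
  by rewrite gcoef_chr eqxx oner_eq0; exact.
by apply/chart_ringP => w; rewrite gcoef_chr; case: (u =P w) => [<- //|_]; rewrite eqxx.
Qed.

Lemma dual_coneD (a b : 'cV[R]_n) : dual_cone sigma a -> dual_cone sigma b -> dual_cone sigma (a + b).
Proof. by move=> da db x sx; rewrite pairingDl addr_ge0 ?da ?db. Qed.

Lemma MrealD u w : Mreal (u + w) = Mreal u + Mreal w :> 'cV[R]_n.
Proof. exact: map_mxD. Qed.

Lemma chart_ring0 : chart_ring sigma 0.
Proof. by apply/chart_ringP => u; rewrite gcoef0 eqxx. Qed.

Lemma chart_ringD f g : chart_ring sigma f -> chart_ring sigma g -> chart_ring sigma (f + g).
Proof.
move=> /chart_ringP cf /chart_ringP cg; apply/chart_ringP => u; rewrite gcoefD.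
by have [->|fu _] := eqVneq f@_u 0; [rewrite add0r; exact: cg | exact: cf].
Qed.

Lemma chart_ringZ (c : C) f : chart_ring sigma f -> chart_ring sigma (c *: f).
Proof.
move=> /chart_ringP cf; apply/chart_ringP => u; rewrite gcoefZ mulf_eq0 negb_or.
by case/andP => _; exact: cf.
Qed.

Lemma chart_ring_sum (I : Type) (r : seq I) (P : pred I) (F : I -> T) :
  (forall i, P i -> chart_ring sigma (F i)) -> chart_ring sigma (\sum_(i <- r | P i) F i).
Proof.
move=> cF; elim/big_rec: _ => [|i f Pi cf]; first exact: chart_ring0.
by apply: chart_ringD => //; exact: cF.
Qed.

Lemma chart_ringM f g : chart_ring sigma f -> chart_ring sigma g -> chart_ring sigma (f * g).
Proof.
move=> cf /chart_ringP cg; rewrite [f]galgE mulr_suml big_seq.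
apply: chart_ring_sum => u uf; rewrite -[X in chart_ring _ X](@scalerAl C T).
apply: chart_ringZ; apply/chart_ringP => w; rewrite gcoef_chrM => gwu.
by rewrite -[w](subrK u) MrealD; apply: dual_coneD; [exact: cg | exact: cf].
Qed.

Lemma chart_ring1 : chart_ring sigma 1.
Proof.
rewrite -(@chr0 R n); apply/chart_ring_chr => x _.
by rewrite /Mreal map_mx0 /pairing mulmx0 mxE.
Qed.

Lemma chart_ringN f : chart_ring sigma f -> chart_ring sigma (- f).
Proof. by rewrite -scaleN1r; exact: chart_ringZ. Qed.

Lemma chart_ring_prod (I : Type) (r : seq I) (P : pred I) (F : I -> T) :
  (forall i, P i -> chart_ring sigma (F i)) -> chart_ring sigma (\prod_(i <- r | P i) F i).
Proof.
move=> cF; elim/big_rec: _ => [|i f Pi cf]; first exact: chart_ring1.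
by apply: chart_ringM => //; exact: cF.
Qed.

Lemma chart_ring_det k (A : 'M[T]_k) :
  (forall i j, chart_ring sigma (A i j)) -> chart_ring sigma (\det A).
Proof.
move=> cA; apply: chart_ring_sum => s _; apply: chart_ringM.
  by case: (perm.odd_perm s); [apply: chart_ringN|]; exact: chart_ring1.
by apply: chart_ring_prod => i _; exact: cA.
Qed.

Lemma chart_sections_preserve k (Theta : kfield R n k) (f : 'I_k -> T) :
  chart_sections sigma Theta -> (forall j, chart_ring sigma (f j)) ->
  chart_ring sigma (Theta f).
Proof.
case=> m [a [D [ca cD ->]]] cf; rewrite fct_sumE; apply: chart_ring_sum => j _.
apply: chart_ringM => //; apply: chart_ring_det => i l; rewrite mxE.
by have [_] := cD j i; apply.
Qed.

(** Each wedge of derivations is expanded by [wedge_derivations], and the resulting coefficients are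
    sorted by weight. *)
Lemma chart_sections_weighted k (Theta : kfield R n k) : chart_sections sigma Theta ->
  exists (U : {fset M}) a, (forall u, homog k (a u)) /\ Theta = weighted U a.
Proof.
case=> m [a [D [ca cD ->]]].
pose h j (s : k.-tuple 'I_n) : T := \det (\matrix_(i, l)
  (D j i (chr (delta_mx (tnth s l) 0)) * chr (- delta_mx (tnth s l) 0))).
have [U [b [hb E]]] := stdprod_weighted (fun s => \sum_j a j * h j s).
exists U, b; split=> //; rewrite -E; apply/funext => f; rewrite !fct_sumE.
under [RHS]eq_bigr do rewrite /fscale mulr_suml.
rewrite exchange_big; apply: eq_bigr => j _; rewrite /fscale.
rewrite wedge_derivations; last by move=> i; have [] := cD j i.
rewrite fct_sumE mulr_sumr; apply: eq_bigr => s _; exact: mulrA.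
Qed.

Lemma chart_sections0 k : chart_sections sigma (0 : kfield R n k).
Proof.
exists 0%N, (fun=> 0), (fun=> (fun=> id)); split=> [[]|[]|] //.
by rewrite big_ord0.
Qed.

Lemma chart_sectionsD k (Th1 Th2 : kfield R n k) :
  chart_sections sigma Th1 -> chart_sections sigma Th2 -> chart_sections sigma (Th1 + Th2).
Proof.
case=> m1 [a1 [D1 [ca1 cD1 ->]]] [m2 [a2 [D2 [ca2 cD2 ->]]]].
exists (m1 + m2)%N,
  (fun j => match fintype.split j with inl i => a1 i | inr i => a2 i end),
  (fun j => match fintype.split j with inl i => D1 i | inr i => D2 i end).
split=> [j|j i|]; [by case: fintype.split | by case: fintype.split |].
have sL i : fintype.split (lshift m2 i) = inl i := unsplitK (inl i).
have sR i : fintype.split (rshift m1 i) = inr i := unsplitK (inr i).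
apply/esym; rewrite big_split_ord; apply: f_equal2; apply: eq_bigr => i _.
  by rewrite sL.
by rewrite sR.
Qed.

Lemma chart_sections_wedge k f (D : 'I_k -> T -> T) : chart_ring sigma f ->
  (forall i, chart_derivation sigma (D i)) -> chart_sections sigma (fscale f (wedge D)).
Proof.
move=> cf cD; exists 1%N, (fun=> f), (fun=> D); split=> //.
by rewrite big_ord1.
Qed.

End ChartRing.

Lemma rho_chrM x u g : rho x (chr u * g) = rho x (chr u) * g + chr u * rho x g.
Proof.
rewrite rho_chr; apply: galg_eq => w.
have eL : (rho x (chr u * g))@_w = g@_(w - u) * cpair w x.
  by rewrite gcoef_rho gcoef_chrM.
have e1 : (cpair u x *: chr u * g)@_w = cpair u x * g@_(w - u).
  by rewrite -(@scalerAl C T) gcoefZ gcoef_chrM.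
have e2 : (chr u * rho x g)@_w = g@_(w - u) * cpair (w - u) x.
  exact: (etrans (gcoef_chrM _ _ _) (gcoef_rho _ _ _)).
apply: (etrans eL); apply/esym; apply: (etrans (gcoefD _ _ _)).
apply: (etrans (f_equal2 +%R e1 e2)).
by rewrite [X in X + _]mulrC -mulrDr -cpairDl [u + _]addrC subrK.
Qed.

Lemma derivation_rho x : derivation (rho x).
Proof.
split=> [|f g]; first exact: rho_linear.
have E1 : rho x (f * g) = \sum_(u <- msupp f) f@_u *: rho x (chr u * g).
  rewrite -(linear_fun_sum _ (fun u => f@_u) (fun u => chr u * g) (rho_linear x)).
  apply: (congr1 (rho x)); rewrite {1}[f]galgE mulr_suml; apply: eq_bigr => u _.
  exact/esym/scalerAl.
have E2 : rho x f = \sum_(u <- msupp f) f@_u *: rho x (chr u).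
  rewrite -(linear_fun_sum _ (fun u => f@_u) chr (rho_linear x)); congr (rho x _).
  exact: galgE.
have E3 : f * rho x g = \sum_(u <- msupp f) f@_u *: (chr u * rho x g).
  rewrite {1}[f]galgE mulr_suml; apply: eq_bigr => u _; exact/esym/scalerAl.
rewrite E1 E2 E3 mulr_suml -big_split; apply: eq_bigr => u _.
rewrite [in LHS]rho_chrM; apply: (etrans (scalerDr _ _ _)).
exact: (f_equal2 +%R (scalerAl _ _ _) (erefl _)).
Qed.

Lemma derivationM h (D : T -> T) : derivation D -> derivation (fun f => h * D f).
Proof.
case=> Dlin Dmul; split=> [c f g|f g].
  rewrite Dlin; apply: (etrans (mulrDr _ _ _)).
  exact: (f_equal2 +%R (galg_scaleAr _ _ _) (erefl _)).
rewrite Dmul; apply: (etrans (mulrDr _ _ _)).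
exact: (f_equal2 +%R (mulrA _ _ _) (mulrCA _ _ _)).
Qed.

End Charts.

(** * Charts of cones spanned by part of a lattice basis *)

Section UnimodularChart.
Variables (R : realType) (n k : nat).
Local Notation C := R[i].
Local Notation T := (torus_ring R n).
Local Notation M := 'cV[int]_n.
Local Notation chr := (@chr R n).
Local Notation rho := (@rho R n).
Variable B : 'M[int]_n.
Hypothesis Bunit : B \in unitmx.
Local Notation BC := (map_mx intr B : 'M[C]_n).
Local Notation E := (fun i => col i (invmx B)).

Lemma pairing_dual (i j : 'I_n) : pairing (E j) (row i B) = (i == j)%:R.
Proof.
rewrite /pairing -row_mul; have -> : B *m col j (invmx B) = col j 1%:M.
  by rewrite -(mulmxV Bunit) !colE mulmxA.
by rewrite !mxE.
Qed.

Lemma map_intr_inv : BC *m map_mx intr (invmx B) = 1%:M.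
Proof. by rewrite -map_mxM mulmxV // map_mx1. Qed.

Lemma map_intr_unit : BC \in unitmx.
Proof. by have [] := mulmx1_unit map_intr_inv. Qed.

Lemma invmx_map_intr : invmx BC = map_mx intr (invmx B).
Proof. by rewrite -[LHS]mulmx1 -map_intr_inv mulmxA mulVmx ?map_intr_unit // mul1mx. Qed.

Lemma charmx_dual (s : k.-tuple 'I_n) :
  charmx R (fun j => E (tnth s j)) = colsub (tnth s) (invmx BC).
Proof. by rewrite invmx_map_intr; apply/matrixP => i j; rewrite !mxE. Qed.

Lemma cpair_intr (u : M) (v : 'rV[int]_n) :
  cpair u (map_mx intr v : 'rV[C]_n) = (pairing u v)%:~R.
Proof. exact: pairing_intr. Qed.

Lemma pairing_sum_dual (p : 'I_n) (s : k.-tuple 'I_n) : increasing s ->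
  pairing (\sum_j E (tnth s j)) (row p B) = (p \in s)%:R.
Proof.
move=> ss; have D (u w : M) : pairing (u + w) (row p B) = pairing u (row p B) + pairing w (row p B).
  exact: pairingDl.
have D0 : pairing 0 (row p B) = 0 by rewrite /pairing mulmx0 mxE.
rewrite (big_morph (fun u => pairing u (row p B)) D D0).
under eq_bigr do rewrite pairing_dual.
have [/tnthP[a ->]|ps] := boolP (p \in s).
  rewrite (bigD1 a) //= eqxx big1 ?addr0 // => j ja.
  by rewrite (inj_eq (increasing_inj ss)) eq_sym (negbTE ja).
by rewrite big1 // => j _; case: eqP => // E; rewrite E mem_tnth in ps.
Qed.

Lemma weighted_ray (U : {fset M}) (a : M -> ext C n) (p : 'I_n) (u : M) :
  (forall u, homog k (a u)) ->
  (forall f : 'I_k -> T, (forall j, chart_ring (@cone R n [:: row p B]) (f j)) ->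
     chart_ring (@cone R n [:: row p B]) (weighted U a f)) ->
  u \in U -> a u != 0 ->
  -1 <= pairing u (row p B) /\
  (pairing u (row p B) = -1 -> annihilated k (row p BC) (a u)).
Proof.
move=> ha wa uU au0.
(* The dual characters are regular on the chart of the ray, hence so is the value of the field on
   them; a nonzero coefficient at [s] makes its exponent $u+\sum_j E_{s_j}$ pair nonnegatively with
   row [p]. *)
have coefE (s : k.-tuple 'I_n) : increasing s ->
    extpair (colsub (tnth s) (invmx BC)) (a u) != 0 ->
    0 <= pairing u (row p B) + (p \in s)%:R.
  move=> ss c0; rewrite -(pairing_sum_dual p ss) -pairingDl.
  have /wa/chart_ringP/(_ (u + \sum_j E (tnth s j))) :
      forall j, chart_ring (@cone R n [:: row p B]) (chr (E (tnth s j))).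
    move=> j; apply/chart_ring_chr/dual_cone_lattice => v; rewrite inE => /eqP->.
    by rewrite pairing_dual; case: eqP.
  rewrite (weighted_chr _ _ uU) charmx_dual => /(_ c0)/dual_cone_lattice.
  by apply; rewrite inE.
have aE := ext_expand map_intr_unit (ha u).
split=> [|up].
  have [s /andP[ss c0]] : exists s : k.-tuple 'I_n,
      increasing s && (extpair (colsub (tnth s) (invmx BC)) (a u) != 0).
    apply/existsP; apply: contraNT au0; rewrite negb_exists => /forallP c0.
    rewrite aE big1 // => s ss; have := c0 s; rewrite ss negbK => /eqP->.
    by rewrite scale0r.
  move: (coefE s ss c0); move: (pairing _ _) => z; rewrite -lerBlDr sub0r.
  by apply: le_trans; rewrite lerN2; case: (p \in s).
(* When the pairing is -1, a product without row [p] would violate [coefE], so its coefficient is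
   0. *)
rewrite aE (bigID (fun s : k.-tuple 'I_n => p \in s)) /= [X in _ + X]big1 ?addr0; last first.
  move=> s /andP[ss ps]; have := coefE s ss; rewrite up (negbTE ps) addr0.
  have [->|_ /(_ isT)] := eqVneq (extpair (colsub (tnth s) (invmx BC)) (a u)) 0.
    by rewrite scale0r.
  by rewrite lerNr oppr0 ler10.
by apply: annihilated_sum => s /andP[_]; exact: annihilated_rowprod.
Qed.

Variable I : {set 'I_n}.
Local Notation sigma := (@cone R n [seq row i B | i <- enum I]).

(** In the coordinates $x_j=\chi^{E_j}$ these are $\partial/\partial x_i$ for [i] in [I] and
    $x_i\,\partial/\partial x_i$ otherwise. In the first case [rho] kills the monomials whose
    pairing with row [i] is 0; the others pair to at least 1, which leaves room for the factor
    $\chi^{-E_i}$. *)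
Lemma chart_derivation_dual (i : 'I_n) : chart_derivation sigma
  (fun f : T => (if i \in I then chr (- E i) else 1) * rho (row i BC) f).
Proof.
split; first exact: derivationM (derivation_rho _).
move=> f /chart_ringP cf; apply/chart_ringP => u.
have [iI|iI] := boolP (i \in I).
  rewrite gcoef_chrM opprK gcoef_rho mulf_eq0 negb_or => /andP[/cf/dual_cone_lattice du].
  rewrite -map_row cpair_intr => ui0; apply/dual_cone_lattice => v vI.
  have := du v vI; move: vI => /mapP[j]; rewrite mem_enum => jI ->.
  rewrite pairingDl pairing_dual; case: (j =P i) => [ji|_]; last by rewrite addr0.
  have : pairing (u + E i) (row i B) != 0 by apply: contra ui0 => /eqP->.
  rewrite ji pairingDl pairing_dual eqxx => ne ge.
  by rewrite -ltzD1 lt_neqAle eq_sym ne.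
by rewrite mul1r gcoef_rho mulf_eq0 negb_or => /andP[/cf].
Qed.

Lemma chart_sections_weight (a : ext C n) (u : M) : homog k a ->
  (forall i, i \in I -> -1 <= pairing u (row i B)) ->
  (forall i, i \in I -> pairing u (row i B) = -1 -> annihilated k (row i BC) a) ->
  chart_sections sigma (fscale (chr u) (rhoN a) : kfield R n k).
Proof.
move=> ha u_ge ka.
pose c (s : k.-tuple 'I_n) := extpair (colsub (tnth s) (invmx BC)) a.
have aE := ext_expand map_intr_unit ha.
have -> : fscale (chr u) (rhoN a) = \sum_(s : k.-tuple 'I_n | increasing s)
    fscale (c s *: chr u) (wedge (fun j => rho (row (tnth s j) BC))) :> kfield R n k.
  apply/funext => f; rewrite fct_sumE /fscale {1}aE rhoN_sum mulr_sumr.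
  apply: eq_bigr => s _; rewrite wedge_rhoN.
  apply: (etrans (galg_scaleAr _ _ _)); exact: scalerAl.
elim/big_rec: _ => [|s Th ss cTh]; first exact: chart_sections0.
apply: chart_sectionsD cTh.
(* The chart derivations carry the factors [g']; the inverse factors [g] move into the coefficient,
   which then has to be regular. *)
pose g (i : 'I_n) : T := if i \in I then chr (E i) else 1.
pose g' (i : 'I_n) : T := if i \in I then chr (- E i) else 1.
have gg' i : g i * g' i = 1.
  rewrite /g /g'; case: (i \in I); last exact: mulr1.
  by rewrite -chrD addrN chr0.
have -> : fscale (c s *: chr u) (wedge (fun j => rho (row (tnth s j) BC))) =
   fscale (c s *: (chr u * \prod_j g (tnth s j)))
     (wedge (fun j f => g' (tnth s j) * rho (row (tnth s j) BC) f)) :> kfield R n k.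
  rewrite wedge_scale; apply/funext => f; rewrite /fscale.
  set W := wedge _ f; set P := \prod_j _; set P' := \prod_j _.
  have PP' : P * P' = 1 by rewrite /P /P' -big_split; apply: big1 => j _; exact: gg'.
  apply: (etrans (esym (scalerAl _ _ _))); apply/esym.
  apply: (etrans (esym (scalerAl _ _ _))); apply: (congr1 (GRing.scale _)).
  apply: (etrans (mulrA _ _ _)); apply: (congr1 ( *%R^~ W)).
  by apply: (etrans (esym (mulrA _ _ _))); rewrite PP' mulr1.
apply: chart_sections_wedge => [|i]; last exact: chart_derivation_dual.
have [->|c0] := eqVneq (c s) 0; first by rewrite scale0r; exact: chart_ring0.
apply: chart_ringZ.
have -> : chr u * \prod_j g (tnth s j) =
    chr (u + \sum_j if tnth s j \in I then E (tnth s j) else 0).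
  rewrite chrD chr_sum; apply: (congr1 (GRing.mul _)); apply: eq_bigr => j _.
  by rewrite /g; case: ifP => // _; exact/esym/chr0.
apply/chart_ring_chr/dual_cone_lattice => v /mapP[ i ]; rewrite mem_enum => iI ->.
have -> : pairing (u + \sum_j if tnth s j \in I then E (tnth s j) else 0) (row i B) =
    pairing u (row i B) + (i \in s)%:R.
  rewrite pairingDl -(pairing_sum_dual i ss) /pairing !mulmx_sumr !summxE.
  congr (_ + _); apply: eq_bigr => j _.
  case: ifP => // sI; have := pairing_dual i (tnth s j); rewrite /pairing => ->.
  by rewrite mulmx0 mxE; case: eqP => // ij; rewrite -ij iI in sI.
(* For [i] in [s] the added character lifts a pairing of at least -1 to at least 0. For [i] outside
   [s] a pairing of -1 would make [c s] vanish by [annihilated_coef], against [c0]. *)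
have := u_ge i iI; have [is_|is_] := boolP (i \in s).
  by move=> _; rewrite -lerBlDr sub0r; exact: u_ge.
rewrite addr0 le_eqVlt => /predU1P[ui|]; last first.
  by rewrite -[X in X < _]sub0r ltrBlDr ltzD1.
by move: c0; rewrite /c (annihilated_coef map_intr_unit (ka i iI (esym ui)) is_) eqxx.
Qed.

End UnimodularChart.

(** * Cones and rays *)

Section SmoothCones.
Variables (R : realType) (n : nat).
Implicit Types (B : 'M[int]_n) (I : {set 'I_n}).
Local Notation cone := (@cone R n).

Lemma intr_inj_mx p q : injective (map_mx intr : 'M[int]_(p, q) -> 'M[R]_(p, q)).
Proof. by move=> A1 A2 /matrixP E; apply/matrixP => i j; have := E i j; rewrite !mxE => /intr_inj. Qed.

Lemma row_unit_inj B : B \in unitmx -> injective (fun i => row i B).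
Proof.
move=> Bu i j E; have := pairing_dual Bu i j; rewrite E pairing_dual // eqxx.
by case: eqP.
Qed.

Lemma cone_rowsP B I x : B \in unitmx ->
  cone [seq row i B | i <- enum I] x <->
  exists c : 'I_n -> R, (forall i, 0 <= c i) /\
     x = \sum_(i in I) c i *: map_mx intr (row i B).
Proof.
move=> Bu; split=> [[c [c0 ->]]|[c [c0 ->]]].
  by exists (fun i => c (row i B)); split=> //; rewrite big_map big_enum.
pose d v := if [pick i | row i B == v] is Some i then c i else 0.
have dE i : d (row i B) = c i.
  rewrite /d; case: pickP => [j /eqP/(row_unit_inj Bu)-> //|/(_ i)].
  by rewrite eqxx.
exists d; split=> [v|]; first by rewrite /d; case: pickP.
by rewrite big_map big_enum; apply: eq_bigr => i _; rewrite dE.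
Qed.

Lemma cone1P (v : 'rV[int]_n) x :
  cone [:: v] x <-> exists2 c : R, 0 <= c & x = c *: map_mx intr v.
Proof.
split=> [[c [c0 ->]]|[c c0 ->]]; first by exists (c v); rewrite ?big_seq1.
by exists (fun=> c); split=> //; rewrite big_seq1.
Qed.

Lemma pairing_dual_intr B (i j : 'I_n) : B \in unitmx ->
  pairing (map_mx intr (col j (invmx B)) : 'cV[R]_n) (map_mx intr (row i B)) = (i == j)%:R.
Proof. by move=> Bu; rewrite pairing_intr pairing_dual // mulrz_nat. Qed.

Lemma pairing_dual_sum B (J : pred 'I_n) (c : 'I_n -> R) (j : 'I_n) : B \in unitmx ->
  pairing (map_mx intr (col j (invmx B)) : 'cV[R]_n)
    (\sum_(i | J i) c i *: map_mx intr (row i B)) = if J j then c j else 0.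
Proof.
move=> Bu; rewrite pairing_sumr big_mkcond (bigD1 j) //= big1 ?addr0 => [|i ij].
  by case: ifP => // _; rewrite pairing_dual_intr // eqxx mulr1.
by case: ifP => // _; rewrite pairing_dual_intr // (negbTE ij) mulr0.
Qed.

(** The supporting functional is the sum of the dual vectors of the other generators; on the cone it
    is the sum of their coefficients, and vanishes only if each of them does. *)
Lemma cone_face_row B I (i : 'I_n) : B \in unitmx -> i \in I ->
  cone_face (cone [:: row i B]) (cone [seq row i B | i <- enum I]).
Proof.
move=> Bu iI; pose u : 'cV[R]_n := \sum_(j in I :\ i) map_mx intr (col j (invmx B)).
have uE (c : 'I_n -> R) :
    pairing u (\sum_(l in I) c l *: map_mx intr (row l B)) = \sum_(j in I :\ i) c j.
  rewrite /pairing mulmx_sumr summxE; apply: eq_bigr => j.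
  by rewrite !inE => /andP[_ jI]; have := pairing_dual_sum (mem I) c j Bu; rewrite /= jI.
exists u; split.
  move=> x /(cone_rowsP _ _ Bu)[c [c0 ->]]; rewrite uE.
  by apply: sumr_ge0 => j _; exact: c0.
apply/predeqP => x; split.
  case/cone1P => c c0 ->.
  have E : c *: map_mx intr (row i B) =
      \sum_(l in I) (if l == i then c else 0) *: map_mx intr (row l B).
    rewrite (bigD1 i) //= eqxx big1 ?addr0 // => l /andP[_ /negbTE->].
    by rewrite scale0r.
  split.
    apply/(cone_rowsP _ _ Bu); exists (fun l => if l == i then c else 0).
    by split=> // l; case: ifP.
  by rewrite E uE big1 // => l; rewrite !inE => /andP[/negbTE->].
case=> /(cone_rowsP _ _ Bu)[c [c0 ->]]; rewrite uE => /eqP.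
rewrite psumr_eq0 // => /allP c00; apply/cone1P; exists (c i) => //.
rewrite (bigD1 i) //= big1 ?addr0 // => l /andP[lI li].
have := c00 l (mem_index_enum _); rewrite !inE li lI => /eqP->.
by rewrite scale0r.
Qed.

Lemma direction_cone1 (v : 'rV[int]_n) : direction (cone [:: v]) = lspan [set map_mx intr v].
Proof.
apply/predeqP => x; split.
  apply: lspan_le => z [y [y' [/cone1P[c _ ->] /cone1P[c' _ ->] ->]]].
  by rewrite -scalerBl; apply/lspanZ/lspan_mem.
apply: lspan_le => z ->; apply: lspan_mem; exists (map_mx intr v), 0; split.
- by apply/cone1P; exists 1; rewrite ?scale1r.
- by apply/cone1P; exists 0; rewrite ?scale0r.
- by rewrite subr0.
Qed.

Lemma cone1_affdim B (i : 'I_n) : B \in unitmx -> has_affdim (cone [:: row i B]) 1.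
Proof.
move=> Bu; exists (fun=> map_mx intr (row i B)); split.
  move=> c; rewrite big_ord1 => c0 j; rewrite (ord1 j).
  have := congr1 (pairing (map_mx intr (col i (invmx B)) : 'cV[R]_n)) c0.
  rewrite /pairing -scalemxAl mul0mx !mxE.
  have := pairing_dual_intr i i Bu; rewrite /pairing mxE => ->.
  by rewrite eqxx mulr1.
rewrite direction_cone1; congr lspan; apply/predeqP => x; split=> [->|[_ _ <-]] //.
by exists ord0.
Qed.

(** All generators are multiples of a single vector; pairing with the dual vectors excludes two
    distinct ones. An empty [I] is excluded because its direction space is 0. *)
Lemma cone_affdim1 B I : B \in unitmx ->
  has_affdim (cone [seq row i B | i <- enum I]) 1 -> exists i, I = [set i]%SET.
Proof.
move=> Bu [b [bi dE]].
have b0 i : i \in I -> exists t, map_mx intr (row i B) = t *: b ord0.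
  move=> iI; have : direction (cone [seq row i B | i <- enum I]) (map_mx intr (row i B)).
    apply: lspan_mem; exists (map_mx intr (row i B)), 0; split; last by rewrite subr0.
      apply/(cone_rowsP _ _ Bu); exists (fun l => (l == i)%:R); split=> [l|]; first exact: ler0n.
      rewrite (bigD1 i) //= eqxx scale1r big1 ?addr0 // => l /andP[_ /negbTE->].
      by rewrite scale0r.
    apply/(cone_rowsP _ _ Bu); exists (fun=> 0); split=> //.
    by rewrite big1 // => l _; rewrite scale0r.
  by rewrite dE => /lspan_rangeP[c ->]; exists (c ord0); rewrite big_ord1.
have [I0|[i iI]] := set_0Vmem I.
  have : direction (cone [seq row i B | i <- enum I]) (b ord0).
    by rewrite dE; apply: lspan_mem; exists ord0.
  have : direction (cone [seq row i B | i <- enum I]) `<=` [set 0].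
    move=> x xd; have : lspan [set (0 : 'rV[R]_n)] x.
      apply: lspan_le xd => z [y [y' [/(cone_rowsP _ _ Bu)[c [_ ->]] /(cone_rowsP _ _ Bu)[c' [_ ->]] ->]]].
      by rewrite I0 !big_set0 subr0; exact: lspan_mem.
    by case=> m [c [s [s0 ->]]]; rewrite /= big1 // => j _; rewrite s0 scaler0.
  move=> /[apply] /= b00; have := bi (fun=> 1).
  rewrite big_ord1 b00 scaler0 => /(_ erefl ord0)/eqP; rewrite oner_eq0 //.
exists i; apply/finset.setP => j; rewrite inE; apply/idP/eqP => [jI|-> //].
apply/eqP; apply: contraT => ji.
have [t ti] := b0 i iI; have [t' tj] := b0 j jI.
pose e l := pairing (map_mx intr (col l (invmx B)) : 'cV[R]_n).
have eZ l (c : R) y : e l (c *: y) = c * e l y by rewrite /e /pairing -scalemxAl mxE.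
have E1 : t * e i (b ord0) = 1 by rewrite -eZ -ti /e pairing_dual_intr // eqxx.
have E2 : t * e j (b ord0) = 0 by rewrite -eZ -ti /e pairing_dual_intr // eq_sym (negbTE ji).
have E3 : t' * e j (b ord0) = 1 by rewrite -eZ -tj /e pairing_dual_intr // eqxx.
move/eqP: E2; rewrite mulf_eq0 => /orP[] /eqP z0.
  by move/eqP: E1; rewrite z0 mul0r eq_sym oner_eq0.
by move/eqP: E3; rewrite z0 mulr0 eq_sym oner_eq0.
Qed.

Lemma primitive_row B (i : 'I_n) : B \in unitmx -> primitive (row i B).
Proof.
move=> Bu d w E; have := pairing_dual Bu i i; rewrite E eqxx.
have -> : pairing (col i (invmx B)) (w *+ d) = pairing (col i (invmx B)) w *+ d.
  by rewrite /pairing -[w *+ d]scaler_nat -scalemxAl mxE mulr_natl.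
rewrite -[LHS]mulr_natl natz => /(congr1 absz); rewrite abszM absz_nat => /eqP.
by rewrite [X in _ == X]/= muln_eq1 => /andP[/eqP].
Qed.

(** [prim_gen] is a choice, so uniqueness is at stake: the chosen generator is a nonnegative
    multiple of [row i B], the factor is an integer by pairing with the dual vector, and primitivity
    makes it 1. *)
Lemma prim_gen_cone1 B (i : 'I_n) : B \in unitmx -> prim_gen (cone [:: row i B]) = row i B.
Proof.
move=> Bu; rewrite /prim_gen; set S := (X in xget _ X).
have Sr : S (row i B) by split=> //; exact: primitive_row.
have [prim E] := xgetPex 0 (ex_intro _ _ Sr); set v := xget 0 S in prim E *.
have /cone1P[c c0 vc] : cone [:: row i B] (map_mx intr v).
  by rewrite E; apply/cone1P; exists 1; rewrite ?scale1r.
pose z := pairing (col i (invmx B)) v.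
have cz : c = z%:~R.
  rewrite /z -pairing_intr vc; rewrite /pairing -scalemxAl mxE.
  by have := pairing_dual_intr i i Bu; rewrite /pairing => ->; rewrite eqxx mulr1.
have z0 : 0 <= z by rewrite -(ler0z R) -cz.
have vz : v = row i B *+ `|z|%N.
  apply: intr_inj_mx; rewrite vc cz -scaler_nat map_mxZ /= rmorph_nat.
  by rewrite natr_absz ger0_norm.
by rewrite vz (prim _ _ vz).
Qed.

End SmoothCones.

(** * Global sections *)

Section GlobalSections.
Variables (R : realType) (n : nat) (Delta : {fset (set 'rV[R]_n)}).
Hypotheses (fan_Delta : is_fan Delta) (smooth_Delta : smooth_fan Delta).
Local Notation C := R[i].
Local Notation T := (torus_ring R n).
Local Notation M := 'cV[int]_n.
Local Notation chr := (@chr R n).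
Local Notation cone := (@cone R n).

Lemma ray_spec r : r \in rays Delta ->
  exists (B : 'M[int]_n) i, [/\ B \in unitmx, r = cone [:: row i B] & prim_gen r = row i B].
Proof.
rewrite !inE /= => /andP[rD /asboolP r1].
have [B [I [Bu rE]]] := smooth_Delta rD.
move: r1; rewrite rE => /(cone_affdim1 Bu)[i Ii].
by exists B, i; rewrite Ii enum_set1 /=; split=> //; exact: prim_gen_cone1.
Qed.

Lemma cone_ray sigma (B : 'M[int]_n) (I : {set 'I_n}) i : sigma \in Delta ->
  B \in unitmx -> sigma = cone [seq row i B | i <- enum I] -> i \in I ->
  cone [:: row i B] \in rays Delta.
Proof.
move=> sD Bu sE iI; rewrite !inE /=; apply/andP; split.
  by apply: (fan_faces fan_Delta sD); rewrite sE; exact: cone_face_row.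
by apply/asboolP; exact: cone1_affdim.
Qed.

Lemma polytope_lattice (u : M) : polytope Delta (Mreal u) <->
  forall r, r \in rays Delta -> -1 <= pairing u (prim_gen r).
Proof.
have E r : (-1 <= pairing (Mreal u) (map_mx intr (prim_gen r) : 'rV[R]_n)) =
    (-1 <= pairing u (prim_gen r)).
  by rewrite pairing_intr -(ler_int R) rmorphN1.
by split=> H r rD; have := H r rD; rewrite E.
Qed.

Lemma active_lattice (u : M) r : (r \in active_rays Delta (Mreal u)) =
  (r \in rays Delta) && (pairing u (prim_gen r) == -1).
Proof.
rewrite [in LHS]inE /= [in LHS]inE /=; congr (_ && _).
by rewrite pairing_intr -(eqr_int R) rmorphN1.
Qed.

Lemma prim_gen_neq0 r : r \in rays Delta -> map_mx intr (prim_gen r) != 0 :> 'rV[C]_n.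
Proof.
case/ray_spec => B [i [Bu _ ->]]; apply/eqP => E0.
have := cpair_intr R (col i (invmx B)) (row i B).
rewrite E0 pairing_dual // eqxx /cpair /pairing mul0mx mxE => /eqP.
by rewrite eq_sym oner_eq0.
Qed.

Lemma mem_Lspace (u : 'cV[R]_n) r : r \in active_rays Delta u ->
  map_mx intr (prim_gen r) \in Lspace Delta u.
Proof. by move=> ru; apply: memv_span; apply/mapP; exists r. Qed.

(** Turns membership in [Nspace] into one condition per active ray, the form in which the charts
    produce and consume it. Sufficiency uses a basis whose first vectors are active generators. *)
Lemma Nspace_annihilated (u : 'cV[R]_n) k a : Nspace Delta u k a <->
  homog k a /\ forall r, r \in active_rays Delta u ->
    annihilated k (map_mx intr (prim_gen r)) a.
Proof.
have active_ray r : r \in active_rays Delta u -> r \in rays Delta.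
  by rewrite inE => /andP[].
split=> [/powspace_annihilated[ha ka]|[ha ka]].
  by split=> // r ru; apply: ka; [exact: mem_Lspace | exact/prim_gen_neq0/active_ray].
have [B Bu BE] := span_basis_complete [seq map_mx intr (prim_gen r) : 'rV[C]_n | r <- active_rays Delta u].
apply: (annihilated_powspace Bu) => // p pL.
  exact/memv_span/BE.
by have /mapP[r ru ->] := BE p pL; exact: ka.
Qed.

Variable k : nat.

Lemma global_sections_weighted (Theta : kfield R n k) : Delta != fset0 ->
  global_sections Delta k Theta -> exists (U : {fset M}) a, Theta = weighted U a /\
    forall u, u \in U -> [/\ polytope Delta (Mreal u), (iindex Delta (Mreal u) <= k)%N
                           & Nspace Delta (Mreal u) k (a u)].
Proof.
case/fset0Pn => sigma0 s0D gT.
have [U [a [ha TE]]] := chart_sections_weighted (gT _ s0D).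
(* Zero components are discarded: the ray conditions concern nonzero [a u], and a nonzero element of
   [Nspace] forces [iindex] to be at most [k]. *)
pose U' := [fset u in U | a u != 0]%fset.
have ray_cond u r : u \in U' -> r \in rays Delta -> -1 <= pairing u (prim_gen r) /\
    (pairing u (prim_gen r) = -1 -> annihilated k (map_mx intr (prim_gen r)) (a u)).
  move=> + rD; rewrite !inE /= => /andP[uU au0]; have [B [i [Bu rE ->]]] := ray_spec rD.
  rewrite map_row; apply: (weighted_ray Bu ha _ uU au0) => f cf.
  rewrite -rE -TE; apply: chart_sections_preserve; last by rewrite rE.
  by apply: gT; move: rD; rewrite !inE => /andP[].
exists U', a; split.
  rewrite TE /weighted (big_fsetID _ (fun u => a u != 0)) /= [X in _ + X]big1_fset ?addr0 //.
  move=> u; rewrite !inE /= negbK => /andP[_ /eqP au0] _; apply/funext => f.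
  rewrite /fscale rhoNE big1 ?mulr0 // => s _; rewrite au0 ffunE; exact: scale0r.
move=> u uU.
have Nu : Nspace Delta (Mreal u) k (a u).
  apply/Nspace_annihilated; split=> // r; rewrite active_lattice => /andP[rD /eqP].
  by have [_] := ray_cond u r uU rD.
split=> //.
  by apply/polytope_lattice => r rD; have [] := ray_cond u r uU rD.
move: Nu uU; rewrite /Nspace !inE /=; case: leqP => // _ ->.
by rewrite eqxx andbF.
Qed.

Lemma weighted_global_sections (U : {fset M}) (a : M -> ext C n) :
  (forall u, u \in U -> polytope Delta (Mreal u) /\ Nspace Delta (Mreal u) k (a u)) ->
  global_sections Delta k (weighted U a : kfield R n k).
Proof.
move=> Ua sigma sD; rewrite /weighted big_seq.
elim/big_rec: _ => [|u Th uU cTh]; first exact: chart_sections0.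
apply: chart_sectionsD cTh.
have [/polytope_lattice Pu /Nspace_annihilated[ha ka]] := Ua u uU.
have [B [I [Bu sE]]] := smooth_Delta sD.
rewrite sE; apply: chart_sections_weight => // i iI.
  by have := Pu _ (cone_ray sD Bu sE iI); rewrite prim_gen_cone1.
move=> ui; rewrite -map_row -(@prim_gen_cone1 R _ _ _ Bu); apply: ka.
by rewrite active_lattice (cone_ray sD Bu sE iI) prim_gen_cone1 // ui eqxx.
Qed.

(** For the identity matrix as lattice basis, the coefficients of [a u] are read off from values of
    the field on the standard characters. *)
Lemma weighted_eq0 (U : {fset M}) (a : M -> ext C n) :
  (forall u, u \in U -> homog k (a u)) -> weighted U a = 0 :> kfield R n k ->
  forall u, u \in U -> a u = 0.
Proof.
move=> ha w0 u uU; have u1 : (1%:M : 'M[int]_n) \in unitmx by exact: unitmx1.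
rewrite (ext_expand (map_intr_unit R u1) (ha u uU)) big1 // => s ss.
by rewrite -charmx_dual // -(weighted_chr _ _ uU) w0 gcoef0 scale0r.
Qed.

End GlobalSections.

(** * Dimensions *)

(** The bases of the summands are put together; the dependent pairs in [J] index the union, and
    [w c u] is the component in [F u]. *)
Lemma direct_sum_has_dim (K : fieldType) (V : lmodType K) (T : choiceType)
    (U : {fset T}) (F : T -> set V) W (d : T -> nat) :
  is_direct_sum [set` U] F W -> (forall u, u \in U -> has_dim (F u) (d u)) ->
  has_dim W (\sum_(u <- U) d u)%N.
Proof.
move=> [WE indep] dimF.
pose b (u : U) : 'I_(d (val u)) -> V := projT1 (cid (dimF _ (valP u))).
have [bi bspan] : (forall u, lin_indep (b u)) /\ (forall u : U, F (val u) = lspan (range (b u))).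
  by split=> u; case: (projT2 (cid (dimF _ (valP u)))).
pose J := {u : U & 'I_(d (val u))}.
pose tg (v : U) (i : 'I_(d (val v))) : J := Tagged (fun v : U => 'I_(d (val v))) i.
pose b' (j : J) := b (tag j) (tagged j).
have <- : #|{: J}| = (\sum_(u <- U) d u)%N.
  rewrite card_tagged sumnE big_map big_enum /= [RHS]big_seq_fsetE /=.
  by apply: eq_big => u //; rewrite card_ord.
pose w (c : J -> K) u := \sum_(j : J | val (tag j) == u) c j *: b' j.
have wF' c (u : U) : F (val u) (w c (val u)).
  rewrite bspan; apply: lspan_sum => -[v i] /= /eqP/val_inj vu; subst v.
  by apply/lspanZ/lspan_mem; exists i.
have wF c u : u \in U -> F u (w c u) by move=> uU; exact: (wF' c [` uU]%fset).
have wsum c : \sum_(u <- U) w c u = \sum_j c j *: b' j.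
  rewrite /w (exchange_big_dep predT) //=; apply: eq_bigr => j _.
  rewrite big_mkcond (big_fsetD1 (val (tag j))) ?fsvalP //= eqxx big1_fset ?addr0 //.
  by move=> u; rewrite !inE => /andP[/negbTE uj _] _; rewrite eq_sym uj.
apply: (has_dim_fin (b := b')) => [c c0 [u i]|x].
  have w0 := indep (enum_fset U) (w c) (fset_uniq U) _ _ _ (fsvalP u).
  have {}w0 : w c (val u) = 0 by apply: w0 => [v vU|]; [split=> //; exact: wF | rewrite wsum].
  apply: (bi u (fun i => c (tg u i))); rewrite -[RHS]w0 /w.
  have E : \sum_(v : U | val v == val u) \sum_(j : 'I_(d (val v))) c (tg v j) *: b v j =
      \sum_(p : J | (val (tag p) == val u) && true)
        c (tg (tag p) (tagged p)) *: b (tag p) (tagged p).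
    exact: (sig_big_dep (fun v : U => val v == val u) (fun v (j : 'I_(d (val v))) => true)
      (fun v j => c (tg v j) *: b v j)).
  move: E; rewrite (big_pred1 u) //= => ->; apply: eq_big => [[v j]|[v j] _] //=.
  by rewrite andbT.
rewrite WE; split=> [[s [y [us sy ->]]]|[c ->]].
  apply/lspan_rangeP; rewrite big_seq; apply: lspan_sum => u us'.
  have [/= uU] := sy u us'; rewrite -[u]/(val [` uU]%fset) bspan.
  apply: lspan_le => _ [i _ <-]; apply: lspan_mem.
  by exists (tg _ i).
exists (enum_fset U), (w c); split=> [|u uU|]; first exact: fset_uniq.
  by split=> //; exact: wF.
by rewrite wsum.
Qed.

(** Removing the initial segment [L] of size [r] maps these tuples bijectively to the subsets of
    size [k - r] of its complement. *)
Lemma card_increasing_above n k r : (r <= k)%N -> (k <= n)%N ->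
  #|[pred s : k.-tuple 'I_n | increasing s & [forall p : 'I_n, (p < r)%N ==> (p \in s)]]|
  = 'C(n - r, k - r).
Proof.
move=> rk kn; pose L := [set p : 'I_n | (p < r)%N]%SET.
have cL : #|L| = r.
  have rn := leq_trans rk kn.
  have winj : injective (widen_ord rn) by move=> p q /(congr1 val)/= /val_inj.
  rewrite -[RHS]card_ord -(card_imset predT winj).
  apply: eq_card => p; rewrite inE; apply/idP/imsetP => [pr|[q _ ->]] /=; last exact: ltn_ord.
  by exists (Ordinal pr) => //; exact: val_inj.
have cLC : #|~: L| = (n - r)%N.
  by rewrite -[X in (X - _)%N]card_ord -(cardsC L) cL addKn.
rewrite -cLC -cards_draws.
pose h (s : k.-tuple 'I_n) := ([set i in s] :\: L)%SET.
have LS (s : k.-tuple 'I_n) : [forall p : 'I_n, (p < r)%N ==> (p \in s)] -> L \subset [set i in s]%SET.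
  by move=> /forallP Ls; apply/fintype.subsetP => p; rewrite !inE; exact/implyP/Ls.
rewrite -(@card_in_imset _ _ h); last first.
  move=> s t /andP[ss Ls] /andP[st Lt] E; apply: increasing_eq => //.
  by rewrite -[LHS](finset.setID _ L) -[RHS](finset.setID _ L) -/(h s) -/(h t) E
    !(finset.setIidPr _) ?LS.
apply: eq_card => S; rewrite inE; apply/imsetP/andP => [[s /andP[ss Ls] ->]|[SL /eqP cS]].
  rewrite /h finset.setDE finset.subsetIr -finset.setDE; split=> //.
  by rewrite cardsDS ?LS // card_increasing // cL.
have dLS : [disjoint L & S]%B by rewrite disjoint_sym finset.disjoints_subset.
have cLS : #|L :|: S| = k.
  by rewrite cardsU cL cS (eqP (_ : L :&: S == finset.set0)) ?finset.setI_eq0 // cards0 subn0 subnKC.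
have [s ss sE] := increasing_enum cLS; exists s.
  rewrite inE ss /=; apply/forallP => p; apply/implyP => pr.
  by have : p \in (L :|: S)%SET by [rewrite !inE pr]; rewrite sE inE.
rewrite /h -sE finset.setDUl finset.setDv finset.set0U; apply/esym/finset.setDidPl.
by rewrite disjoint_sym.
Qed.

Section WeightSpaces.
Variables (R : realType) (n k : nat) (Delta : {fset (set 'rV[R]_n)}).
Hypotheses (fan_Delta : is_fan Delta) (smooth_Delta : smooth_fan Delta).
Local Notation C := R[i].
Local Notation T := (torus_ring R n).
Local Notation M := 'cV[int]_n.
Local Notation chr := (@chr R n).

Lemma fscale_rhoN_sum (I : Type) (r : seq I) (P : pred I) (c : I -> C) (F : I -> ext C n) (u : M) :
  fscale (chr u) (rhoN (\sum_(i <- r | P i) c i *: F i)) =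
  \sum_(i <- r | P i) c i *: (fscale (chr u) (rhoN (F i))) :> kfield R n k.
Proof.
apply/funext => f; rewrite fct_sumE /fscale rhoN_sum mulr_sumr.
by apply: eq_bigr => i _; exact: galg_scaleAr.
Qed.

Lemma fscale_rhoN_eq0 (a : ext C n) (u : M) : homog k a ->
  fscale (chr u) (rhoN a) = 0 :> kfield R n k -> a = 0.
Proof.
move=> ha e; have := @weighted_eq0 R n k [fset u]%fset (fun=> a) (fun _ _ => ha).
rewrite /weighted big_seq_fset1 => /(_ e u); apply; exact: fset11.
Qed.

(** In a basis adapted to [Lspace] the products of [k] rows that include the first [r] form a basis
    of [Nspace], and [fscale_rhoN_eq0] keeps them independent as fields. *)
Lemma weight_space_dim (u : M) : (k <= n)%N ->
  has_dim (weight_space Delta k u)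
    (binom (n - iindex Delta (Mreal u)) (k%:Z - (iindex Delta (Mreal u))%:Z)).
Proof.
move=> kn; rewrite /weight_space gchar_chr; set r := iindex _ _.
have [rk|kr] := leqP r k; last first.
  have -> : binom (n - r) (k%:Z - r%:Z) = 0%N.
    (* [Negz m] stands for [-(m + 1)], whence the predecessor. *)
    have -> : (k%:Z - r%:Z = Negz (r - k).-1)%R by rewrite NegzE; lia.
    by [].
  rewrite -(card_ord 0); apply: (has_dim_fin (b := fun _ : 'I_0 => 0)) => [c _ []//|x].
  have -> : Nspace Delta (Mreal u) k = [set 0] by rewrite /Nspace leqNgt kr.
  have E : fscale (chr u) (rhoN (0 : ext C n)) = 0 :> kfield R n k.
    have := fscale_rhoN_sum [::] xpredT (fun _ : nat => 0) (fun=> 0) u.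
    by rewrite !big_nil.
  split=> [[_ -> <-]|[c ->]]; first by exists (fun=> 0); rewrite big_ord0.
  by exists 0 => //; rewrite big_ord0.
have -> : binom (n - r) (k%:Z - r%:Z) = 'C(n - r, k - r) by rewrite subzn.
rewrite -(card_increasing_above rk kn) -card_sig.
have [B Bu BE] := span_basis_complete
  [seq map_mx intr (prim_gen r) : 'rV[C]_n | r <- active_rays Delta (Mreal u)].
have BL (p : 'I_n) : (p < r)%N -> row p B \in Lspace Delta (Mreal u).
  by move=> pr; exact/memv_span/BE.
pose J := {s : k.-tuple 'I_n |
  s \in [pred s : k.-tuple 'I_n | increasing s & [forall p : 'I_n, (p < r)%N ==> (p \in s)]]}.
pose b (j : J) : kfield R n k := fscale (chr u) (rhoN (rowprod B (val j))).
have incJ (j : J) : increasing (val j) by case/andP: (valP j).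
have NJ (c : J -> C) : Nspace Delta (Mreal u) k (\sum_j c j *: rowprod B (val j)).
  apply: (annihilated_powspace Bu BL).
    by apply: homog_sum => j _; apply/homogZ/extprod_homog.
  move=> p pr; apply: annihilated_sum => j _; apply: annihilated_rowprod.
  by case/andP: (valP j) => _ /forallP/(_ p)/implyP; exact.
apply: (has_dim_fin (b := b)) => [c|x].
  rewrite -fscale_rhoN_sum => /fscale_rhoN_eq0 c0 j.
  have {}c0 := c0 (proj1 (powspace_annihilated (NJ c))).
  have : extpair (colsub (tnth (val j)) (invmx B)) (\sum_j c j *: rowprod B (val j)) = 0.
    by rewrite c0 /extpair big1 // => s _; rewrite ffunE mul0r.
  rewrite extpair_sum (bigD1 j) //= (extpair_rowprod Bu (incJ j) (incJ j)) eqxx mulr1 big1 ?addr0 // => l lj.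
  by rewrite (extpair_rowprod Bu (incJ j) (incJ l)) (inj_eq val_inj) (negbTE lj) mulr0.
split=> [[a Na <-]|[c ->]]; last first.
  by exists (\sum_j c j *: rowprod B (val j)); [exact: NJ | exact: fscale_rhoN_sum].
exists (fun j : J => extpair (colsub (tnth (val j)) (invmx B)) a).
rewrite -fscale_rhoN_sum; congr (fscale _ (rhoN _)).
have [ha ka] := (Nspace_annihilated smooth_Delta _ _ _).1 Na.
rewrite {1}(ext_expand Bu ha).
rewrite (bigID (fun s : k.-tuple 'I_n => [forall p : 'I_n, (p < r)%N ==> (p \in s)])) /=.
rewrite [X in _ + X]big1 ?addr0; last first.
  move=> s /andP[ss]; rewrite negb_forall => /existsP[p]; rewrite negb_imply => /andP[pr ps].
  rewrite (@annihilated_coef _ _ _ _ Bu p) ?scale0r //.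
  by have /mapP[q qa ->] := BE p pr; exact: ka.
apply: etrans (big_sub _ (fun s : k.-tuple 'I_n =>
  extpair (colsub (tnth s) (invmx B)) a *: rowprod B s)).
by apply: eq_bigl => s; rewrite inE.
Qed.

Lemma weight_spaceP u Th : weight_space Delta k u Th <->
  exists2 a, Nspace Delta (Mreal u) k a & Th = fscale (chr u) (rhoN a).
Proof.
rewrite /weight_space gchar_chr; split=> [[a Na <-]|[a Na ->]]; first by exists a.
by exists a.
Qed.

Lemma weight_space_direct_sum : Delta != fset0 ->
  is_direct_sum [set u : M | polytope Delta (Mreal u) /\ (iindex Delta (Mreal u) <= k)%N]
    (weight_space Delta k) (global_sections Delta k).
Proof.
move=> D0; split.
  apply/predeqP => Th; split.
    case/(global_sections_weighted smooth_Delta D0) => U [a [-> Ua]].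
    exists (enum_fset U), (fun u => fscale (chr u) (rhoN (a u))).
    split=> [||//]; first exact: fset_uniq.
    move=> u uU; have [Pu iu Nu] := Ua u uU; split=> //.
    by apply/weight_spaceP; exists (a u).
  case=> s [w [us sw ->]].
  have wa u : exists a, u \in s -> Nspace Delta (Mreal u) k a /\ w u = fscale (chr u) (rhoN a).
    have [us'|_] := boolP (u \in s); last by exists 0.
    by have [_ /weight_spaceP[a Na wE]] := sw u us'; exists a.
  have [a aE] := choice wa.
  have -> : \sum_(u <- s) w u = weighted [fset u in s]%fset a.
    rewrite /weighted [RHS](perm_big s) /=; last first.
      by apply: uniq_perm; [exact: fset_uniq | | move=> u; rewrite inE].
    rewrite big_seq [RHS]big_seq; apply: eq_bigr => u us'.
    by have [_ ->] := aE u us'.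
  apply: (weighted_global_sections fan_Delta smooth_Delta) => u; rewrite inE => us'.
  by have [[Pu _] _] := sw u us'; have [Nu _] := aE u us'.
move=> s w us sw w0 u us'.
have wa v : exists a, v \in s -> Nspace Delta (Mreal v) k a /\ w v = fscale (chr v) (rhoN a).
  have [vs|_] := boolP (v \in s); last by exists 0.
  by have [_ /weight_spaceP[a Na wE]] := sw v vs; exists a.
have [a aE] := choice wa.
have sE : \sum_(v <- s) w v = weighted [fset v in s]%fset a.
  rewrite /weighted [RHS](perm_big s) /=; last first.
    by apply: uniq_perm; [exact: fset_uniq | | move=> v; rewrite inE].
  rewrite big_seq [RHS]big_seq; apply: eq_bigr => v vs.
  by have [_ ->] := aE v vs.
have a0 : a u = 0.
  apply: (weighted_eq0 (U := [fset v in s]%fset) _ _ (k := k)); last by rewrite inE.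
    by move=> v; rewrite inE => /aE[/powspace_annihilated[]].
  by rewrite -sE.
have [_ ->] := aE u us'; rewrite a0.
have := fscale_rhoN_sum [::] xpredT (fun _ : nat => 0) (fun=> 0) u.
by rewrite !big_nil.
Qed.

End WeightSpaces.

(** * Faces of the polytope *)

Section Dimension.
Variables (K : fieldType) (V : lmodType K).

(** The two matrices of base change have the identity of size [d1] as product, which factors through
    size [d2]. *)
Lemma has_dim_le (W : set V) d1 d2 : has_dim W d1 -> has_dim W d2 -> (d1 <= d2)%N.
Proof.
move=> [b1 [b1i W1]] [b2 [b2i W2]].
have E1 i : exists c : 'I_d2 -> K, b1 i = \sum_j c j *: b2 j.
  by apply/lspan_rangeP; rewrite -W2 W1; apply: lspan_mem; exists i.
have E2 j : exists c : 'I_d1 -> K, b2 j = \sum_l c l *: b1 l.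
  by apply/lspan_rangeP; rewrite -W1 W2; apply: lspan_mem; exists j.
have [c1 c1E] := choice E1; have [c2 c2E] := choice E2.
apply: (@mulmx1_min K _ _ (\matrix_(i, j) c1 i j) (\matrix_(j, l) c2 j l)).
apply/matrixP => i l; rewrite !mxE.
pose e l := (\sum_j c1 i j * c2 j l) - (i == l)%:R.
have e0 : \sum_l e l *: b1 l = 0.
  under eq_bigr do rewrite /e scalerBl.
  rewrite big_split /= sumrN [X in _ - X](bigD1 i) //= eqxx scale1r.
  rewrite [X in _ - (_ + X)]big1 ?addr0 => [|l' /negbTE li]; last by rewrite eq_sym li scale0r.
  apply/eqP; rewrite subr_eq0 [b1 i]c1E; apply/eqP.
  under eq_bigr do rewrite scaler_suml.
  rewrite exchange_big; apply: eq_bigr => j _; rewrite [b2 j]c2E scaler_sumr.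
  by apply: eq_bigr => l' _; rewrite scalerA.
have /eqP := b1i e e0 l; rewrite subr_eq0 => /eqP <-.
by apply: eq_bigr => j _; rewrite !mxE.
Qed.

Lemma has_dim_unique (W : set V) d1 d2 : has_dim W d1 -> has_dim W d2 -> d1 = d2.
Proof. by move=> h1 h2; apply/eqP; rewrite eqn_leq !(has_dim_le h1 h2, has_dim_le h2 h1). Qed.

End Dimension.

Section RealRank.
Variables (R : realType) (n : nat).

(** Rank is unchanged by the field extension from the reals to the complex numbers: [iindex] is a
    complex dimension, while faces live over the reals. *)
Lemma dim_span_intr (X : seq 'rV[int]_n) :
  \dim <<[seq map_mx intr v : 'rV[R[i]]_n | v <- X]>>%VS =
  \rank (\matrix_(i < size X) map_mx intr X`_i : 'M[R]_(size X, n)).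
Proof.
rewrite -(mxrank_map (real_complex R)) -dim_span_rows; congr (\dim <<_>>).
apply: (@eq_from_nth _ 0); rewrite size_map ?size_tuple // => j jX.
rewrite (nth_map 0) // -[j]/(val (Ordinal jX)) -tnth_nth tnth_mktuple.
by apply/rowP => l; rewrite !mxE rmorph_int.
Qed.

Lemma has_dim_kernel m (A : 'M[R]_(m, n)) :
  has_dim [set z : 'cV[R]_n | A *m z = 0] (n - \rank A).
Proof.
have -> : (n - \rank A = \rank (kermx A^T))%N by rewrite mxrank_ker mxrank_tr.
set N := kermx A^T; set Bs := row_base N.
have kerP (z : 'cV[R]_n) : A *m z = 0 <-> (z^T <= N)%MS.
  split=> [Az|/sub_kermxP zA].
    by apply/sub_kermxP; rewrite -trmx_mul Az trmx0.
  by apply: (can_inj trmxK); rewrite trmx_mul zA trmx0.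
have cE (c : 'I_(\rank N) -> R) :
    (\sum_i c i *: (row i Bs)^T)^T = (\row_i c i) *m Bs.
  rewrite mulmx_sum_row linear_sum; apply: eq_bigr => i _.
  by rewrite mxE linearZ /= trmxK.
exists (fun i => (row i Bs)^T); split.
  move=> c /(congr1 trmx); rewrite cE trmx0 -(mul0mx _ Bs).
  by move=> /(row_free_inj (row_base_free N))/rowP E i; have := E i; rewrite !mxE.
apply/predeqP => z; split.
  move/kerP; rewrite -(eq_row_base N) => /submxP[c zE]; apply/lspan_rangeP.
  exists (fun i => c 0 i); apply: (can_inj trmxK); rewrite cE zE; congr (_ *m _).
  by apply/rowP => i; rewrite mxE.
move/lspan_rangeP => [c ->]; apply/kerP; rewrite cE -(eq_row_base N).
exact: submxMl.
Qed.

End RealRank.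

(** One radius for the finitely many inequalities that define the polytope. *)
Lemma uniform_pos (R : realType) (T : eqType) (s : seq T) (Q : T -> R -> Prop) :
  (forall x e e', e' <= e -> Q x e -> Q x e') ->
  (forall x, x \in s -> exists2 e, 0 < e & Q x e) ->
  exists2 e, 0 < e & forall x, x \in s -> Q x e.
Proof.
move=> Qle; elim: s => [_|x s IH Qs]; first by exists 1.
have [e e0 xe] := Qs x (mem_head _ _).
have [|e' e'0 se] := IH; first by move=> y ys; apply: Qs; rewrite inE ys orbT.
exists (Num.min e e'); first by rewrite lt_min e0.
move=> y; rewrite inE => /predU1P[->|ys]; first by apply: Qle xe; rewrite ge_min lexx.
by apply: Qle (se y ys); rewrite ge_min lexx orbT.
Qed.

Section Near.
Variables (R : realType) (n : nat).
Implicit Types (u z : 'cV[R]_n) (v : 'rV[R]_n).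

Lemma pairingZ (t : R) u v : pairing (t *: u) v = t * pairing u v.
Proof. by rewrite /pairing -scalemxAr mxE. Qed.

Lemma pairingB u z v : pairing (u - z) v = pairing u v - pairing z v.
Proof. by rewrite -scaleN1r pairingDl pairingZ mulN1r. Qed.

Lemma near_line u z (Q : set 'cV[R]_n) : (\forall u' \near u, Q u') ->
  exists2 e : R, 0 < e & Q (u + e *: z).
Proof.
(* [N] exceeds the absolute value of every entry of [z], so the step [d / N] stays in the ball of
   radius [d]; the summand 1 keeps [N] positive for [z = 0]. *)
case/nbhs_ballP => d /= d0 dQ; pose N := 1 + \sum_i `|z i 0|.
have N0 : 0 < N by rewrite ltr_pwDl // sumr_ge0.
exists (d / N); first by rewrite divr_gt0.
apply: dQ; split=> // i j; rewrite (ord1 j) !mxE /ball /= opprD addNKr normrN normrM.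
rewrite gtr0_norm ?divr_gt0 // mulrAC ltr_pdivrMr // ltr_pM2l //.
by rewrite /N (bigD1 i) //= addrCA ltrDl ltr_pwDl // sumr_ge0.
Qed.

Lemma near_pairing u v (c : R) : c < pairing u v ->
  exists2 e : R, 0 < e & forall u', ball u e u' -> c < pairing u' v.
Proof.
move=> cu; pose N := 1 + \sum_i `|v 0 i|.
have N0 : 0 < N by rewrite ltr_pwDl // sumr_ge0.
exists ((pairing u v - c) / N); first by rewrite divr_gt0 // subr_gt0.
move=> u' [_ uu']; have : `|pairing (u - u') v| < pairing u v - c; last first.
  by rewrite pairingB => /ltr_normlW; lra.
rewrite /pairing mxE; apply: le_lt_trans (ler_norm_sum _ _ _) _.
have lt0 : 0 < pairing u v - c by rewrite subr_gt0.
apply: (@le_lt_trans _ _ ((pairing u v - c) / N * \sum_i `|v 0 i|)).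
  rewrite mulr_sumr; apply: ler_sum => i _; rewrite !mxE normrM mulrC.
  by apply: ler_wpM2r => //; apply: ltW; exact: uu'.
by rewrite mulrAC ltr_pdivrMr // ltr_pM2l // /N ltrDr.
Qed.

End Near.

Section Faces.
Variables (R : realType) (n : nat) (Delta : {fset (set 'rV[R]_n)}).
Local Notation P := (polytope Delta).
Local Notation gen r := (map_mx intr (prim_gen r) : 'rV[R]_n).
Implicit Types (u z x : 'cV[R]_n) (F : set 'cV[R]_n).

(** The orthogonal of the active generators in $M_{\mathbb{R}}$; by [relint_direction] it is the
    direction of the face around [u]. *)
Definition active_kernel u : set 'cV[R]_n :=
  [set z | forall r, r \in active_rays Delta u -> pairing z (gen r) = 0].

Lemma active_rayP u r :
  reflect (r \in rays Delta /\ pairing u (gen r) = -1) (r \in active_rays Delta u).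
Proof.
have -> : (r \in active_rays Delta u) = (r \in rays Delta) && (pairing u (gen r) == -1).
  by rewrite [in LHS]inE /= [in LHS]inE.
by apply: (iffP andP) => -[rD /eqP].
Qed.

Lemma iindex_le u : (iindex Delta u <= n)%N.
Proof. by have := dimvS (subvf (Lspace Delta u)); rewrite dimvf /dim /= mul1n. Qed.

Lemma has_dim_active_kernel u : has_dim (active_kernel u) (n - iindex Delta u).
Proof.
pose X := [seq prim_gen r | r <- active_rays Delta u].
have -> : iindex Delta u = \rank (\matrix_(i < size X) map_mx intr X`_i : 'M[R]_(size X, n)).
  by rewrite -dim_span_intr /iindex /Lspace /X -map_comp.
suff -> : active_kernel u = [set z | (\matrix_(i < size X) map_mx intr X`_i) *m z = 0].
  exact: has_dim_kernel.
apply/predeqP => z; split=> [Z|/matrixP Z r ru].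
  apply/matrixP => i j; rewrite (ord1 j) [RHS]mxE.
  have /mapP[r ru rE] : X`_i \in X by rewrite mem_nth.
  rewrite -(Z r ru) /pairing -rE !mxE; apply: eq_bigr => l _.
  by rewrite !mxE.
have rX : prim_gen r \in X by apply/mapP; exists r.
have iX : (index (prim_gen r) X < size X)%N by rewrite index_mem.
have := Z (Ordinal iX) 0; rewrite [RHS]mxE => <-.
by rewrite /pairing -[in LHS](nth_index 0 rX) !mxE; apply: eq_bigr => l _; rewrite !mxE.
Qed.

Lemma active_move u z : P u -> active_kernel u z ->
  exists2 e : R, 0 < e & forall t, `|t| <= e -> P (u + t *: z).
Proof.
move=> Pu Zz.
have [|r rD|e e0 eP] := @uniform_pos R _ (enum_fset (rays Delta))
    (fun r e => forall t, `|t| <= e -> -1 <= pairing (u + t *: z) (gen r)).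
- by move=> x e e' ee' H t te; apply: H; exact: le_trans ee'.
- have [ra|nra] := boolP (r \in active_rays Delta u).
    exists 1 => // t _; rewrite pairingDl pairingZ Zz // mulr0 addr0.
    by have /active_rayP[_ ->] := ra.
  have lt1 : -1 < pairing u (gen r).
    rewrite lt_neqAle Pu // andbT eq_sym; apply: contra nra => /eqP ur.
    exact/active_rayP.
  set a := pairing u _ in lt1 *; set b := pairing z (gen r).
  have b0 : 0 < 1 + `|b| by rewrite ltr_pwDl.
  (* The slack [a + 1] of the inactive inequality, divided by more than the rate [|b|] at which
     moving along [z] can consume it. *)
  exists ((a + 1) / (1 + `|b|)); first by rewrite divr_gt0 //; lra.
  move=> t; rewrite ler_pdivlMr // => tb; rewrite pairingDl pairingZ -/a -/b.
  have : `|t * b| <= a + 1.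
    by apply: le_trans tb; rewrite normrM ler_wpM2l // lerDr.
  by rewrite ler_norml => /andP[+ _]; lra.
by exists e => // t te r rD; exact: eP.
Qed.

Lemma direction_sub u F :
  (forall x, F x -> forall r, r \in active_rays Delta u -> pairing x (gen r) = -1) ->
  direction F `<=` active_kernel u.
Proof.
move=> Fu z [m [c [s [sF ->]]]] r ru; rewrite /pairing mulmx_sumr summxE big1 // => i _.
have [x [y [Fx Fy ->]]] := sF i.
by rewrite -scalemxAr mxE -/(pairing (x - y) (gen r)) pairingB (Fu x) // (Fu y) // subrr mulr0.
Qed.

Lemma face_sub F : is_face F P -> F `<=` P.
Proof. by case=> _ [w ->] x []. Qed.

(** From [u] one can move a little away from [x] and stay in [F]. If [x] paired to more than -1 with
    an active generator, the new point would pair to less than -1. *)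
Lemma relint_active F u : is_face F P -> relint F u ->
  forall x, F x -> forall r, r \in active_rays Delta u -> pairing x (gen r) = -1.
Proof.
move=> Ff [Fu nF] x Fx r /active_rayP[rD ur].
have [e e0 eF] := near_line (u - x) nF.
have : F (u + e *: (u - x)).
  apply: eF; exists u, (e *: (u - x)); split=> //.
  by apply/lspanZ/lspan_mem; exists u, x.
move=> /(face_sub Ff)/(_ r rD); rewrite pairingDl pairingZ pairingB ur => h.
have := face_sub Ff Fx rD; set p := pairing x _ in h * => hp.
apply/eqP; rewrite eq_le hp andbT.
have : 0 <= e * (-1 - p) by lra.
by rewrite pmulr_rge0 //; lra.
Qed.

(** Both [u + e *: z] and [u - e *: z] lie in the polytope, and [w] is minimal at [u]. *)
Lemma face_active_kernel F u z (w : 'rV[R]_n) :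
  F = [set u | P u /\ forall u', P u' -> pairing u w <= pairing u' w] ->
  F u -> active_kernel u z -> pairing z w = 0.
Proof.
move=> -> [Pu umin] Zz; have [e e0 eP] := active_move Pu Zz.
have := umin _ (eP e _); rewrite gtr0_norm // lexx => /(_ isT).
have := umin _ (eP (- e) _); rewrite normrN gtr0_norm // lexx => /(_ isT).
rewrite !pairingDl !pairingZ => h1 h2.
have h : e * pairing z w = 0 by lra.
by move/eqP: h; rewrite mulf_eq0 gt_eqF //= => /eqP.
Qed.

Lemma relint_direction F u : is_face F P -> relint F u -> direction F = active_kernel u.
Proof.
move=> Ff uF; apply/seteqP; split; first exact/direction_sub/relint_active.
have [_ [w FE]] := Ff; have [Fu _] := uF; move=> z Zz.
have zw := face_active_kernel FE Fu Zz.
have [Pu umin] : P u /\ forall u', P u' -> pairing u w <= pairing u' w by rewrite FE in Fu.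
have [e e0 eP] := active_move Pu Zz.
have -> : z = e^-1 *: ((u + e *: z) - u).
  by rewrite addrC addKr scalerA mulVf ?gt_eqF // scale1r.
apply/lspanZ/lspan_mem; exists (u + e *: z), u; split=> //.
rewrite FE; split; first by apply: eP; rewrite gtr0_norm.
by move=> u' Pu'; rewrite pairingDl pairingZ zw mulr0 addr0; exact: umin.
Qed.

Lemma relint_iindex F u i : is_face F P -> has_codim F i -> relint F u -> iindex Delta u = i.
Proof.
move=> Ff [d [dF di]] uF; move: dF; rewrite /has_affdim (relint_direction Ff uF) => dF.
have := has_dim_unique dF (has_dim_active_kernel u).
by have := iindex_le u; lia.
Qed.

(* The smallest face of the polytope that contains u. *)
Definition carrier u : set 'cV[R]_n :=
  [set x | P x /\ forall r, r \in active_rays Delta u -> pairing x (gen r) = -1].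

(** The functional is the sum [w] of the active generators: on the polytope each summand is at least
    -1, so the minimum is reached exactly where all are -1. *)
Lemma carrier_face u : P u -> is_face (carrier u) P.
Proof.
move=> Pu; pose w : 'rV[R]_n := \sum_(r <- active_rays Delta u) gen r.
have wE x : pairing x w = \sum_(r <- active_rays Delta u) pairing x (gen r).
  by rewrite /w /pairing mulmx_suml summxE.
have uu : carrier u u by split=> // r /active_rayP[].
split; first by exists u.
exists w; apply/predeqP => x; split=> [[Px xa]|[Px xmin]].
  split=> // y Py; rewrite !wE big_seq [X in _ <= X]big_seq; apply: ler_sum => r ra.
  by rewrite xa //; apply: Py; have /active_rayP[] := ra.
split=> // r ra; have := xmin u Pu; rewrite !wE => le_xu.
have d0 s : s \in active_rays Delta u -> 0 <= pairing x (gen s) - pairing u (gen s).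
  by move=> /active_rayP[sD ->]; rewrite subr_ge0 Px.
have : \sum_(s <- active_rays Delta u) (pairing x (gen s) - pairing u (gen s)) <= 0.
  by rewrite big_split /= sumrN subr_le0.
rewrite (big_fsetD1 r) //= => le0.
have ge0 : 0 <= \sum_(s <- (active_rays Delta u `\ r)%fset) (pairing x (gen s) - pairing u (gen s)).
  by rewrite big_seq sumr_ge0 // => s; rewrite !inE => /andP[_ sa]; apply: d0; rewrite !inE.
have := d0 r ra; have /active_rayP[_ ->] := ra; move: le0.
have /active_rayP[_ ->] := ra; move: ge0; set S := \sum_(s <- _) _.
by lra.
Qed.

(** Inequalities inactive at [u] stay strict in a small ball, and the active ones remain equalities
    on the affine hull. *)
Lemma carrier_relint u : P u -> relint (carrier u) u.
Proof.
move=> Pu; have uu : carrier u u by split=> // r /active_rayP[].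
split=> //.
have [|r rD|e e0 eP] := @uniform_pos R _ (enum_fset (rays Delta)) (fun r e =>
    r \notin active_rays Delta u -> forall u', ball u e u' -> -1 < pairing u' (gen r)).
- by move=> r e e' ee' H nr u' uu'; apply: H => //; exact: le_ball uu'.
- have [ra|nra] := boolP (r \in active_rays Delta u); first by exists 1.
  have lt1 : -1 < pairing u (gen r).
    rewrite lt_neqAle Pu // andbT eq_sym; apply: contra nra => /eqP ur.
    exact/active_rayP.
  by have [e e0 eP] := near_pairing lt1; exists e.
apply/nbhs_ballP; exists e => //= u' uu' [x [w [[Px xa] dw u'E]]]; rewrite u'E in uu' *.
have wZ : active_kernel u w by apply: direction_sub dw => y [].
split=> [r rD|r ra]; last by rewrite pairingDl xa // wZ // addr0.
have [ra|nra] := boolP (r \in active_rays Delta u).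
  by rewrite pairingDl xa // wZ // addr0.
exact/ltW/(eP r rD).
Qed.

(** The minimizing functional of [F] is constant along [active_kernel u], so [F] contains all of
    [carrier u]. Hence a point lies in the relative interior of only one face. *)
Lemma relint_carrier F u : is_face F P -> relint F u -> F = carrier u.
Proof.
move=> Ff uF; apply/seteqP; split=> x.
  by move=> Fx; split; [exact: face_sub Fx | exact: relint_active Fx].
case=> Px xa; have [_ [w FE]] := Ff; have [Fu _] := uF.
have Z : active_kernel u (x - u).
  by move=> r ra; rewrite pairingB xa //; have /active_rayP[_ ->] := ra; rewrite subrr.
have := face_active_kernel FE Fu Z; rewrite pairingB => /eqP; rewrite subr_eq0 => /eqP xw.
by move: Fu; rewrite FE => -[_ umin]; split=> // u' Pu'; rewrite xw; exact: umin.
Qed.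

Lemma carrier_codim u : P u -> has_codim (carrier u) (iindex Delta u).
Proof.
move=> Pu; exists (n - iindex Delta u)%N; split; last by rewrite subnK // iindex_le.
rewrite /has_affdim (relint_direction (carrier_face Pu) (carrier_relint Pu)).
exact: has_dim_active_kernel.
Qed.

End Faces.

(** * Lattice points *)

Section Counting.
Variables (R : realType) (n : nat) (Delta : {fset (set 'rV[R]_n)}).
Hypotheses (fan_Delta : is_fan Delta) (smooth_Delta : smooth_fan Delta).
Hypothesis complete_Delta : complete_fan Delta.
Local Notation P := (polytope Delta).
Local Notation M := 'cV[int]_n.

(** By completeness [x] is a nonnegative combination of ray generators, each of which pairs to at
    least -1 with the polytope; [c] is the sum of the coefficients. *)
Lemma polytope_pairing_ge (x : 'rV[R]_n) :
  exists c : R, forall u, P u -> - c <= pairing u x.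
Proof.
have [sigma sD] := complete_Delta x.
have [B [I [Bu sE]]] := smooth_Delta sD.
rewrite sE => /(cone_rowsP _ _ Bu)[c [c0 ->]].
exists (\sum_(l in I) c l) => u Pu; rewrite pairing_sumr -sumrN; apply: ler_sum => l lI.
have := Pu _ (cone_ray fan_Delta sD Bu sE lI); rewrite prim_gen_cone1 // => h.
by rewrite -[leLHS]mulrN1 ler_wpM2l.
Qed.

Lemma polytope_bounded : exists N : nat, forall u : M, P (Mreal u) ->
  forall i, `|u i 0| <= N%:Z.
Proof.
have bnd i : exists c : R, forall u, P u -> `|u i 0| <= c.
  have [c1 h1] := polytope_pairing_ge (delta_mx 0 i).
  have [c2 h2] := polytope_pairing_ge (- delta_mx 0 i).
  have E u : pairing u (delta_mx 0 i : 'rV[R]_n) = u i 0 by rewrite /pairing -rowE mxE.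
  have E' u : pairing u (- delta_mx 0 i : 'rV[R]_n) = - u i 0.
    by rewrite -E /pairing mulNmx mxE.
  exists (Num.max c1 c2) => u Pu; rewrite ler_norml; apply/andP; split.
    by rewrite lerNl; apply: (@le_trans _ _ c1); rewrite ?le_max ?lexx // lerNl -E h1.
  apply: (@le_trans _ _ c2); rewrite ?le_max ?lexx ?orbT // -lerN2 -E'; exact: h2.
have [c cE] := choice bnd.
exists (Num.bound (\sum_i `|c i|)) => u Pu i; rewrite -(ler_int R) intr_norm.
apply: (@le_trans _ _ (\sum_i `|c i|)); last by apply: ltW; rewrite archi_boundP // sumr_ge0.
apply: (@le_trans _ _ (c i)); first by have := cE i _ Pu; rewrite mxE.
by rewrite (bigD1 i) //= (le_trans (ler_norm _)) // lerDl sumr_ge0.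
Qed.

Lemma finite_lattice_points : finite_set [set u : M | P (Mreal u)].
Proof.
have [N Nb] := polytope_bounded.
(* The box of integer vectors with entries between [-N] and [N], shifted by [N] so that ordinals
   enumerate it. *)
pose h (f : {ffun 'I_n -> 'I_(N + N).+1}) : M := \col_i ((f i : nat)%:Z - N%:Z).
apply: (@sub_finite_set _ _ (range h)); last exact/finite_image/finite_finset.
move=> u /Nb uN; exists [ffun i => inord (absz (u i 0 + N%:Z))] => //.
apply/matrixP => i j; rewrite (ord1 j) mxE ffunE.
have := uN i; rewrite ler_norml => /andP[h1 h2].
have h3 : 0 <= u i 0 + N%:Z by lia.
by rewrite inordK ?gez0_abs //; lia.
Qed.

(** The lattice points with [iindex] equal to [i] are partitioned by their carriers, which are faces
    of codimension [i]. *)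
Lemma card_relint_lattice i :
  (\sum_(F \in [set F | is_face F P /\ has_codim F i])
      #|` fset_set [set u : M | relint F (Mreal u)]|)%N =
  #|` fset_set [set u : M | P (Mreal u) /\ iindex Delta (Mreal u) = i]|.
Proof.
set L := [set u : M | P (Mreal u) /\ _].
have finL : finite_set L.
  by apply: sub_finite_set finite_lattice_points => u [].
have finF F : is_face F P -> finite_set [set u : M | relint F (Mreal u)].
  by move=> Ff; apply: sub_finite_set finite_lattice_points => u [/(face_sub Ff)].
pose r := [fset carrier Delta (Mreal u) | u in fset_set L]%fset.
have memL u : u \in fset_set L <-> P (Mreal u) /\ iindex Delta (Mreal u) = i.
  by rewrite in_fset_set //; split=> [/set_mem|/mem_set].
have relP F : F \in r -> is_face F P /\ has_codim F i.
  case/imfsetP => u /= /memL[Pu <-] ->.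
  by split; [exact: carrier_face | exact: carrier_codim].
(* The sum over faces reduces to the finite set [r]: by [relint_carrier] any other face of
   codimension [i] has no lattice point in its relative interior and contributes 0. *)
rewrite (fsbigE (enum_fset r)); first last.
- move=> F [Ff Fi] Fr; apply/eqP; rewrite cardfs_eq0; apply/eqP/fsetP => u.
  rewrite inE in_fset_set; last exact: finF.
  apply: contraNF Fr => /set_mem uF; apply/imfsetP; exists u; last exact: relint_carrier.
  apply/memL; split; first by have [/(face_sub Ff)] := uF.
  exact: relint_iindex Fi uF.
- by move=> F /= /relP.
- exact: fset_uniq.
rewrite [RHS]card_fset_sum1 (partition_big_imfset _ (fun u => carrier Delta (Mreal u))) /=.
rewrite big_mkcond big_seq [RHS]big_seq; apply: eq_bigr => F Fr.
have [Ff Fi] := relP F Fr.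
rewrite mem_set // card_fset_sum1 [RHS]big_fset_condE.
suff -> : fset_set [set u : M | relint F (Mreal u)] =
    [fset u in fset_set L | carrier Delta (Mreal u) == F]%fset by [].
apply/fsetP => u; rewrite in_fset_set; last exact: finF.
rewrite !inE /=; apply/idP/andP => [/set_mem uF|[/memL[Pu ui] /eqP <-]].
  split; last by rewrite -(relint_carrier Ff uF).
  apply/memL; split; first by have [/(face_sub Ff)] := uF.
  exact: relint_iindex Fi uF.
by apply/mem_set; exact: carrier_relint.
Qed.

Lemma global_sections_dim k : (k <= n)%N ->
  has_dim (global_sections Delta k)
    (\sum_(0 <= i < k.+1) 'C(n - i, k - i) *
       \sum_(F \in [set F | is_face F P /\ has_codim F i])
          #|` fset_set [set u : M | relint F (Mreal u)]|)%N.
Proof.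
move=> kn; have D0 : Delta != fset0.
  by have [sigma sD _] := complete_Delta 0; apply/fset0Pn; exists sigma.
set I := [set u : M | P (Mreal u) /\ (iindex Delta (Mreal u) <= k)%N].
have finI : finite_set I by apply: sub_finite_set finite_lattice_points => u [].
have memI u : u \in fset_set I <-> P (Mreal u) /\ (iindex Delta (Mreal u) <= k)%N.
  by rewrite in_fset_set //; split=> [/set_mem|/mem_set].
have ds := weight_space_direct_sum k fan_Delta smooth_Delta D0.
rewrite -/I -(fset_setK finI) in ds.
have := direct_sum_has_dim ds (fun u _ => weight_space_dim smooth_Delta u kn).
congr has_dim; rewrite big_mkord.
(* On the index set [iindex] is at most [k], so [inord] does not alter it. *)
rewrite (partition_big (fun u => inord (iindex Delta (Mreal u)) : 'I_k.+1) predT) //=.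
apply: eq_bigr => i _; rewrite card_relint_lattice card_fset_sum1 big_distrr /= muln1.
have finL : finite_set [set u : M | P (Mreal u) /\ iindex Delta (Mreal u) = i].
  by apply: sub_finite_set finite_lattice_points => u [].
rewrite big_fset_condE.
have -> : [fset u in fset_set I | inord (iindex Delta (Mreal u)) == i]%fset =
    fset_set [set u : M | P (Mreal u) /\ iindex Delta (Mreal u) = i].
  apply/fsetP => u; rewrite in_fset_set // !inE /=.
  apply/andP/idP => [[/memI[Pu uk] /eqP <-]|/set_mem[Pu ui]].
    by apply/mem_set; rewrite inordK.
  split; first by apply/memI; rewrite ui -ltnS.
  by apply/eqP/val_inj; rewrite /= ui inordK.
rewrite big_seq [RHS]big_seq; apply: eq_bigr => u; rewrite in_fset_set // => /set_mem[_ ->].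
by rewrite subzn // -ltnS.
Qed.

End Counting.

Theorem theorem1 (R : realType) (n : nat) (Delta : {fset (set 'rV[R]_n)})
    (fan_Delta : is_fan Delta) (smooth_Delta : smooth_fan Delta)
    (complete_Delta : complete_fan Delta) (k : nat)
    (k_ge1 : (1 <= k)%N) (k_le_n : (k <= n)%N) :
  [/\ is_direct_sum
        [set u : 'cV[int]_n | polytope Delta (Mreal u) /\
                              (iindex Delta (Mreal u) <= k)%N]
        (weight_space Delta k)
        (global_sections Delta k),
      forall (F : set 'cV[R]_n) (i : nat),
        is_face F (polytope Delta) -> has_codim F i ->
        (forall u : 'cV[R]_n, relint F u -> iindex Delta u = i) /\
        (forall u : 'cV[int]_n, relint F (Mreal u) ->
           has_dim (weight_space Delta k u) (binom (n - i) (k%:Z - i%:Z)))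
    & has_dim (global_sections Delta k)
        (\sum_(0 <= i < k.+1) 'C(n - i, k - i) *
           \sum_(F \in [set F | is_face F (polytope Delta) /\ has_codim F i])
              #|` fset_set [set u : 'cV[int]_n | relint F (Mreal u)]|)%N ].
Proof.
(* Some cone covers the origin, so the fan is not empty; without a chart every field would count as
   a global section. *)
have D0 : Delta != fset0.
  by have [sigma sD _] := complete_Delta 0; apply/fset0Pn; exists sigma.
split; first exact: weight_space_direct_sum.
  move=> F i Ff Fi; split=> [u|u uF]; first exact: relint_iindex.
  by rewrite -(relint_iindex Ff Fi uF); exact: weight_space_dim.
exact: global_sections_dim.
Qed.
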